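(* Let $A$ be the generator of a bounded $C_0$-semigroup $\{T(t)\}_{t\ge0}$ on a Banach space $X$, and suppose $\sigma_p(A^{\odot})\cap i\mathbb R=\emptyset$. If $t\mapsto\langle x,T^{\odot}(t)x^{\odot}\rangle$ is Eberlein weakly almost periodic on $[0,\infty)$ for all $x\in X$, $x^{\odot}\in X^{\odot}$, then $$\lim_{T\to\infty}\frac1T\int_0^T|\langle x,T^{\odot}(t)x^{\odot}\rangle|\,dt=0\quad\text{for all }x\in X,\ x^{\odot}\in X^{\odot}.$$
   Context: $X^{\odot}=\{x^*\in X^*:\lim_{t\to0}\|T^*(t)x^*-x^*\|=0\}$ is a norm-closed, weak*-dense, $T^*(t)$-invariant subspace of $X^*$; $T^{\odot}(t)=T^*(t)|_{X^{\odot}}$ is a $C_0$-semigroup on $X^\odot$ with generator $A^\odot$ (the part of $A^*$ in $X^\odot$: $D(A^\odot)=\{x^*\in D(A^* )\cap X^\odot: A^*x^*\in X^\odot\}$). $\sigma_p$ denotes point spectrum. A bounded continuous function $f:[0,\infty)\to\mathbb C$ is Eberlein weakly almost periodic if $\{f(\cdot+\tau):\tau\ge0\}$ is weakly relatively compact in $C_b([0,\infty))$. *)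

(* Defs.v *)
From HB Require Import structures.
From mathcomp Require Import all_boot all_order all_algebra.
From mathcomp Require Import all_classical all_reals all_analysis.
From mathcomp Require Import complex.

Set Implicit Arguments.
Unset Strict Implicit.
Unset Printing Implicit Defensive.

Import Order.TTheory GRing.Theory Num.Theory.
Import numFieldNormedType.Exports.

Local Open Scope classical_set_scope.
Local Open Scope ring_scope.
Local Open Scope complex_scope.

(* [R[i]] as a one-dimensional normed space over itself; the norm [`|z|] of a
   complex vector space takes its values in [R[i]]. *)
HB.instance Definition _ (R : realType) := NormedModule.copy R[i] R[i]^o.

(* Suprema of sets of nonnegative reals embedded in [R[i]]. *)
Definition csup (R : realType) (A : set R[i]) : R[i] :=
  (sup [set complex.Re z | z in A])%:C.

Section csup_theory.
Variable R : realType.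
Implicit Types (A : set R[i]) (z M : R[i]).

Lemma ge0_ReK z : 0 <= z -> (complex.Re z)%:C = z.
Proof. by case: z => a b; rewrite lecE /= => /andP[/eqP -> _]. Qed.

Lemma csup_ub A M z : (forall w, A w -> w <= M) -> A z -> 0 <= z ->
  z <= csup A.
Proof.
move=> AM Az z0; rewrite -(ge0_ReK z0) /csup lecR; apply: ub_le_sup.
  exists (complex.Re M) => _ [w Aw <-].
  by have := AM _ Aw; rewrite lecE => /andP[].
by exists z.
Qed.

Lemma csup_le A M : A !=set0 -> (forall w, A w -> w <= M) -> 0 <= M ->
  csup A <= M.
Proof.
move=> [a Aa] AM M0; rewrite -(ge0_ReK M0) /csup lecR; apply: sup_le_ub.
  by exists (complex.Re a); exists a.
by move=> _ [w Aw <-]; have := AM _ Aw; rewrite lecE => /andP[].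
Qed.

Lemma csup_set0 : csup (set0 : set R[i]) = 0.
Proof. by rewrite /csup image_set0 sup0. Qed.

End csup_theory.

Section bounded_operators.
Variables (R : realType) (X Y : normedModType R[i]).
Local Notation C := R[i].

Definition bop_pred : {pred X -> Y} :=
  mem [set f : X -> Y | linear f /\ continuous f].

Record bop := Bop { bop_val :> X -> Y; _ : bop_val \in bop_pred }.

HB.instance Definition _ := [isSub for bop_val].
HB.instance Definition _ := [Choice of bop by <:].

Lemma bop_submod_closed : submod_closed bop_pred.
Proof.
split=> [|a f g].
  rewrite inE; split=> [a u v|]; first by rewrite /= scaler0 addr0.
  exact: cst_continuous.
rewrite !inE => -[lf cf] [lg cg]; split=> [b u v|x].
  rewrite !fctE lf lg !scalerDr !scalerA mulrC !addrA; congr (_ + _).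
  by rewrite -!addrA; congr (_ + _); rewrite addrC.
by apply: cvgD; [apply: cvgZr; exact: cf|exact: cg].
Qed.

HB.instance Definition _ := GRing.isSubmodClosed.Build C (X -> Y) bop_pred
  bop_submod_closed.
HB.instance Definition _ := [SubChoice_isSubLmodule of bop by <:].

Lemma bop_linear (f : bop) : linear f.
Proof. by case: f => f /= /[!inE] -[]. Qed.

HB.instance Definition _ (f : bop) :=
  GRing.isLinear.Build C X Y *:%R (bop_val f) (bop_linear f).

Lemma bop_continuous (f : bop) : continuous f.
Proof. by case: f => f /= /[!inE] -[]. Qed.

Lemma bopP (f g : bop) : f =1 g -> f = g.
Proof. by move=> fg; apply: val_inj; apply: funext. Qed.

Definition opnorm (f : bop) : C := csup [set `|f x| | x in [set x | `|x| <= 1]].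

Lemma bop_bounded (f : bop) :
  exists2 M : C, 0 <= M & forall x, `|f x| <= M * `|x|.
Proof.
have /linear_boundedP := @continuous_linear_bounded _ _ _ 0 f (@bop_continuous f 0).
move=> /pinfty_ex_gt0[M M0 fM]; exists M => //; exact: ltW.
Qed.

Lemma opnorm_ub1 (f : bop) x : `|x| <= 1 -> `|f x| <= opnorm f.
Proof.
move=> x1; have [M M0 fM] := bop_bounded f.
apply: (@csup_ub _ _ M) => //; last by exists x.
by move=> _ [y y1 <-]; rewrite (le_trans (fM y))// ler_piMr.
Qed.

Lemma opnorm_le (f : bop) (M : C) : 0 <= M ->
  (forall x, `|x| <= 1 -> `|f x| <= M) -> opnorm f <= M.
Proof.
move=> M0 fM; apply: csup_le => //; last by move=> _ [x x1 <-]; exact: fM.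
by exists `|f 0|, 0 => //=; rewrite normr0.
Qed.

Lemma opnorm_ge0 (f : bop) : 0 <= opnorm f.
Proof.
by rewrite (le_trans (normr_ge0 (f 0)))// opnorm_ub1// normr0.
Qed.

Lemma opnorm_ub (f : bop) x : `|f x| <= opnorm f * `|x|.
Proof.
have [->|x0] := eqVneq x 0; first by rewrite linear0 !normr0 mulr0.
have nx : 0 < `|x| by rewrite normr_gt0.
rewrite -ler_pdivrMr//.
have -> : `|f x| / `|x| = `|f (`|x|^-1 *: x)|.
  by rewrite linearZ normrZ ger0_norm ?invr_ge0// mulrC.
by apply: opnorm_ub1; rewrite normrZ ger0_norm ?invr_ge0// mulVf// gt_eqF.
Qed.

Lemma opnormD (f g : bop) : opnorm (f + g) <= opnorm f + opnorm g.
Proof.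
apply: opnorm_le; first by rewrite addr_ge0// opnorm_ge0.
move=> x x1; rewrite (le_trans (ler_normD (f x) (g x)))//.
by rewrite lerD// opnorm_ub1.
Qed.

Lemma opnormZ (a : C) (f : bop) : opnorm (a *: f) = `|a| * opnorm f.
Proof.
have le b (g : bop) : opnorm (b *: g) <= `|b| * opnorm g.
  apply: opnorm_le; first by rewrite mulr_ge0// opnorm_ge0.
  move=> x x1; have -> : (b *: g) x = b *: g x by [].
  by rewrite normrZ ler_wpM2l// opnorm_ub1.
apply/eqP; rewrite eq_le le /=; have [->|a0] := eqVneq a 0.
  by rewrite normr0 mul0r opnorm_ge0.
rewrite -ler_pdivlMl ?normr_gt0//.
have {1}-> : f = a^-1 *: (a *: f) by rewrite scalerA mulVf// scale1r.
by rewrite (le_trans (le _ _))// normfV.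
Qed.

Lemma opnorm_eq0 (f : bop) : opnorm f = 0 -> f = 0.
Proof.
move=> f0; apply: bopP => x; apply/eqP; rewrite -normr_le0.
by have := opnorm_ub f x; rewrite f0 mul0r.
Qed.

HB.instance Definition _ := Lmodule_isNormed.Build C bop
  opnormD opnormZ opnorm_eq0.

End bounded_operators.

(* The norm dual $X^*$; the pairing <x, y> is [y x]. *)
Notation dual X := (bop X (complex _)).

Section adjoint.
Variables (R : realType) (X : normedModType R[i]).

Lemma adjoint_subproof (S : bop X X) (y : dual X) :
  ((y : X -> R[i]) \o S) \in @bop_pred R X R[i].
Proof.
rewrite inE; split=> [a u v|x]; first by rewrite /= !linearP.
by apply: continuous_comp; exact: bop_continuous.
Qed.

Definition adjoint (S : bop X X) (y : dual X) : dual X :=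
  Bop (adjoint_subproof S y).

End adjoint.

Section bounded_continuous.
Variables (R : realType) (S : topologicalType).
Local Notation C := R[i].

Definition cb_pred : {pred S -> C} :=
  mem [set f : S -> C | continuous f /\ bounded_fun f].

(* $C_b(S)$ with the supremum norm. *)
Record cb := Cb { cb_val :> S -> C; _ : cb_val \in cb_pred }.

HB.instance Definition _ := [isSub for cb_val].
HB.instance Definition _ := [Choice of cb by <:].

Lemma bounded_funE (f : S -> C) :
  bounded_fun f <-> exists2 M : C, 0 <= M & forall s, `|f s| <= M.
Proof.
split=> [/pinfty_ex_gt0[M M0 fM]|[M M0 fM]].
  by exists M; [exact: ltW|move=> s; exact: fM].
exists M; split; first exact: ger0_real.
by move=> N MN s _ /=; rewrite (le_trans (fM s))// ltW.
Qed.

Lemma cb_submod_closed : submod_closed cb_pred.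
Proof.
split=> [|a f g].
  rewrite inE; split=> [|]; first exact: cst_continuous.
  by apply/bounded_funE; exists 0 => // s; rewrite normr0.
rewrite !inE => -[cf /bounded_funE[M M0 fM]] [cg /bounded_funE[N N0 gN]].
split=> [x|].
  by apply: cvgD; [apply: cvgZr; exact: cf|exact: cg].
apply/bounded_funE; exists (`|a| * M + N) => [|s].
  by rewrite addr_ge0// mulr_ge0.
rewrite !fctE (le_trans (ler_normD _ _))// lerD// normrZ.
by rewrite ler_wpM2l.
Qed.

HB.instance Definition _ := GRing.isSubmodClosed.Build C (S -> C) cb_pred
  cb_submod_closed.
HB.instance Definition _ := [SubChoice_isSubLmodule of cb by <:].

Lemma cb_continuous (f : cb) : continuous f.
Proof. by case: f => f /= /[!inE] -[]. Qed.

Lemma cb_bounded (f : cb) : bounded_fun f.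
Proof. by case: f => f /= /[!inE] -[]. Qed.

Lemma cbP (f g : cb) : f =1 g -> f = g.
Proof. by move=> fg; apply: val_inj; apply: funext. Qed.

Definition supnorm (f : cb) : C := csup [set `|f s| | s in [set: S]].

Lemma supnorm_ub (f : cb) s : `|f s| <= supnorm f.
Proof.
have /bounded_funE[M M0 fM] := cb_bounded f.
by apply: (@csup_ub _ _ M) => // _ [t _ <-].
Qed.

Lemma supnorm_le (f : cb) (M : C) : 0 <= M ->
  (forall s, `|f s| <= M) -> supnorm f <= M.
Proof.
move=> M0 fM; rewrite /supnorm.
have [->|A0] := eqVneq [set `|f s| | s in [set: S]] set0.
  by rewrite csup_set0.
by apply: csup_le => // [|_ [t _ <-]]; [exact/set0P|exact: fM].
Qed.

Lemma supnorm_ge0 (f : cb) : 0 <= supnorm f.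
Proof.
rewrite /supnorm; have [->|/set0P[_ [s _ _]]] :=
  eqVneq [set `|f s| | s in [set: S]] set0; first by rewrite csup_set0.
exact: le_trans (supnorm_ub f s).
Qed.

Lemma supnormD (f g : cb) : supnorm (f + g) <= supnorm f + supnorm g.
Proof.
apply: supnorm_le; first by rewrite addr_ge0// supnorm_ge0.
move=> s; rewrite (le_trans (ler_normD (f s) (g s)))//.
by rewrite lerD// supnorm_ub.
Qed.

Lemma supnormZ (a : C) (f : cb) : supnorm (a *: f) = `|a| * supnorm f.
Proof.
have le b (g : cb) : supnorm (b *: g) <= `|b| * supnorm g.
  apply: supnorm_le; first by rewrite mulr_ge0// supnorm_ge0.
  move=> x; have -> : (b *: g) x = b *: g x by [].
  by rewrite normrZ ler_wpM2l// supnorm_ub.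
apply/eqP; rewrite eq_le le /=; have [->|a0] := eqVneq a 0.
  by rewrite normr0 mul0r supnorm_ge0.
rewrite -ler_pdivlMl ?normr_gt0//.
have {1}-> : f = a^-1 *: (a *: f) by rewrite scalerA mulVf// scale1r.
by rewrite (le_trans (le _ _))// normfV.
Qed.

Lemma supnorm_eq0 (f : cb) : supnorm f = 0 -> f = 0.
Proof.
move=> f0; apply: cbP => x; apply/eqP; rewrite -normr_le0.
by have := supnorm_ub f x; rewrite f0.
Qed.

HB.instance Definition _ := Lmodule_isNormed.Build C cb
  supnormD supnormZ supnorm_eq0.

End bounded_continuous.

(* The weak topology of a normed space V: the topology induced by the embedding
   of V, by evaluation, in the space of functions on the dual of V, with the
   topology of pointwise convergence. *)
Definition weak (R : realType) (V : normedModType R[i]) : topologicalType :=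
  initial_topology
    ((fun v phi => phi v) : V -> {ptws dual V -> R[i]}).

Definition halfline (R : realType) : topologicalType :=
  set_type (`[0, +oo[%classic : set R).

Definition hlval (R : realType) : halfline R -> R := set_val.

Section almost_periodicity.
Variable R : realType.

Lemma hlval_ge0 (t : halfline R) : 0 <= hlval t.
Proof.
by case: t => t t0; have := set_mem t0; rewrite /= in_itv /= andbT.
Qed.

Lemma hlval_continuous : continuous (@hlval R).
Proof. exact: initial_continuous. Qed.

Lemma addhl_subproof (s t : halfline R) :
  hlval s + hlval t \in `[0%R, +oo[%classic.
Proof. by rewrite inE /= in_itv /= andbT addr_ge0// hlval_ge0. Qed.

Definition addhl (s t : halfline R) : halfline R :=
  exist _ (hlval s + hlval t) (addhl_subproof s t).

Lemma addhlr_continuous (tau : halfline R) : continuous (addhl ^~ tau).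
Proof.
apply: (@continuous_comp_initial _ _ _ (@hlval R)) => t.
exact: (cvgD (@hlval_continuous t) (cvg_cst (hlval tau))).
Qed.

Lemma translate_subproof (tau : halfline R) (f : cb R (halfline R)) :
  (fun t => f (addhl t tau)) \in @cb_pred R (halfline R).
Proof.
rewrite inE; split.
  move=> t; apply: (@continuous_comp _ _ _ (addhl ^~ tau) f).
    exact: addhlr_continuous.
  exact: cb_continuous.
have /bounded_funE[M M0 fM] := @cb_bounded _ _ f.
by apply/bounded_funE; exists M.
Qed.

Definition translate (tau : halfline R) (f : cb R (halfline R)) :
  cb R (halfline R) := Cb (translate_subproof tau f).

Definition eberlein_wap (f : halfline R -> R[i]) : Prop :=
  exists2 F : cb R (halfline R), f = F &
    precompact ([set translate tau F | tau in [set: halfline R]]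
                : set (weak (cb R (halfline R)))).

End almost_periodicity.

Section semigroups.
Variables (R : realType) (X : normedModType R[i]).

(* Semigroups are indexed by [R], but only the values at nonnegative times are
   constrained or used. *)
Definition c0_semigroup (T : R -> bop X X) : Prop :=
  [/\ forall x, T 0 x = x,
      forall s t x, 0 <= s -> 0 <= t -> T (s + t) x = T s (T t x) &
      forall x, T t x @[t --> 0^'+] --> x].

Definition bounded_semigroup (T : R -> bop X X) : Prop :=
  [bounded T t | t in `[0, +oo[%classic].

End semigroups.

(* Unbounded operators are represented by their graphs. *)
Section unbounded_operators.
Variables (R : realType) (X : normedModType R[i]).

Definition generator (T : R -> bop X X) : set (X * X) :=
  [set p | (h^-1)%:C *: (T h p.1 - p.1) @[h --> 0^'+] --> p.2].

(* The adjoint of a densely defined operator. *)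
Definition adjoint_graph (A : set (X * X)) : set (dual X * dual X) :=
  [set p : dual X * dual X | forall q, A q -> p.1 q.2 = p.2 q.1].

Definition part (A : set (X * X)) (Z : set X) : set (X * X) :=
  [set p | [/\ A p, Z p.1 & Z p.2]].

Definition point_spectrum (A : set (X * X)) : set R[i] :=
  [set l | exists2 x, x != 0 & A (x, l *: x)].

End unbounded_operators.

Definition imaginary_axis (R : realType) : set R[i] :=
  [set z | complex.Re z = 0].

Section sun_dual.
Variables (R : realType) (X : normedModType R[i]).

(* $X^\odot$ *)
Definition sun_dual (T : R -> bop X X) : set (dual X) :=
  [set y | `|adjoint (T t) y - y| @[t --> 0^'+] --> (0 : R[i])].

(* $T^\odot(t)$, to be applied to elements of $X^\odot$ only *)
Definition sun_semigroup (T : R -> bop X X) (t : R) :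
  dual X -> dual X := adjoint (T t).

(* $A^\odot$, where $A$ is the generator of $T$ *)
Definition sun_generator (T : R -> bop X X) (A : set (X * X)) :
    set (dual X * dual X) :=
  part (adjoint_graph A) (sun_dual T).

End sun_dual.

(* Main.v *)
Require Import Defs.
From mathcomp Require Import all_boot all_order all_algebra.
From mathcomp Require Import all_classical all_reals all_analysis.
From mathcomp Require Import complex.
From mathcomp Require cyclic separable cyclotomic.
From mathcomp Require Import ring lra.

Set Implicit Arguments.
Unset Strict Implicit.
Unset Printing Implicit Defensive.

Import Order.TTheory GRing.Theory Num.Theory.
Import numFieldNormedType.Exports.

Local Open Scope classical_set_scope.
Local Open Scope ring_scope.
Local Open Scope complex_scope.

(* Write f(t) = <x, T(t)* y>.  Since A^sun has no eigenvalue on the imaginary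
   axis, the averages of f(t) z^t over intervals tend to 0 uniformly in |z| = 1
   and in the position of the interval: otherwise a weak-star limit of averages
   of T(t)* y would be an eigenfunctional.  By a Wiener type argument (Plancherel
   on a finite cyclic group), for every invariant mean m there are translates
   f_n of f that are asymptotically orthogonal for the form m(g h-bar).  By weak
   compactness they have a weak limit h, which is orthogonal to each f_n, so that
   m(|f_n - h|^2) >= m(|f|^2) for all n, although f_n - h tends to 0 pointwise
   and, by the double limit criterion, on all ultrafilters of points.  Dominated
   convergence for the finitely additive m then forces m(|f|^2) = 0.  All means
   are limits along ultrafilters of Riemann sums on dyadic grids. *)

(** * Real-valued norms and ultralimits *)

(** The mean m is only finitely additive, so bounded pointwise convergence gives nothing by itself:
    the indicators of [n, oo) decrease to 0 and all have mean 1. Their two iterated limits differ,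
    however, and that is exactly what weak compactness of the translates forbids. A grid of step d
    sees only the single operator T(d)*, whereas the spectral hypothesis concerns the generator. The
    sums are therefore taken on a grid finer than a modulus of continuity of the orbit. Frequencies
    away from 1 then cancel by summation by parts; at the remaining ones, refining the grid loses
    only a factor 2 and the oscillation of the orbit over one step. The limit functional is thus
    nonzero, and every T(r)*, not only T(d)*, multiplies it by a phase. The dyadic grids make m
    meaningful for every bounded function and exactly invariant under dyadic translations, the only
    ones chosen. *)

Definition nrm (R : realType) (V : normedZmodType R[i]) (v : V) : R :=
  complex.Re `|v|.

Section nrm_theory.
Variables (R : realType) (V : normedZmodType R[i]).
Implicit Types u v : V.

Lemma nrmE v : `|v| = (nrm v)%:C.
Proof. by rewrite /nrm ge0_ReK. Qed.

Lemma nrm_ge0 v : 0 <= nrm v.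
Proof. by rewrite -lecR -nrmE normr_ge0. Qed.

Lemma nrmD u v : nrm (u + v) <= nrm u + nrm v.
Proof. by rewrite -lecR rmorphD /= -!nrmE ler_normD. Qed.

Lemma nrmN v : nrm (- v) = nrm v.
Proof. by rewrite /nrm normrN. Qed.

Lemma nrmB u v : nrm (u - v) <= nrm u + nrm v.
Proof. by rewrite -(nrmN v) nrmD. Qed.

Lemma nrm_distC u v : nrm (u - v) = nrm (v - u).
Proof. by rewrite -nrmN opprB. Qed.

Lemma nrm0 : nrm (0 : V) = 0.
Proof. by rewrite /nrm normr0. Qed.

Lemma nrm_sum (I : Type) (r : seq I) (P : pred I) (f : I -> V) :
  nrm (\sum_(i <- r | P i) f i) <= \sum_(i <- r | P i) nrm (f i).
Proof.
elim/big_ind2 : _ => //; first by rewrite nrm0.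
by move=> x1 x2 y1 y2 h1 h2; rewrite (le_trans (nrmD _ _))// lerD.
Qed.

End nrm_theory.

Section complex_nrm.
Variable R : realType.
Implicit Types (z w : R[i]) (r : R).

Lemma nrmM z w : nrm (z * w) = nrm z * nrm w.
Proof. by apply: (@complexI R); rewrite rmorphM /= -!nrmE normrM. Qed.

Lemma nrmX z n : nrm (z ^+ n) = nrm z ^+ n.
Proof. by apply: (@complexI R); rewrite rmorphXn /= -!nrmE normrX. Qed.

Lemma nrmZ (V : normedModType R[i]) z (v : V) : nrm (z *: v) = nrm z * nrm v.
Proof. by apply: (@complexI R); rewrite rmorphM /= -!nrmE normrZ. Qed.

Lemma sqr_nrm z : nrm z ^+ 2 = complex.Re z ^+ 2 + complex.Im z ^+ 2.
Proof. by apply: (@complexI R); rewrite add_Re2_Im2 nrmE rmorphXn. Qed.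

Lemma nrm_real r : nrm r%:C = `|r|.
Proof.
apply/eqP; rewrite -(@eqrXn2 _ 2)// ?nrm_ge0// sqr_nrm /=.
by rewrite expr0n addr0 real_normK ?num_real.
Qed.

Lemma mulcJ z : z * conjc z = (nrm z ^+ 2)%:C.
Proof.
rewrite sqr_nrm; case: z => a b /=; apply/eqP; rewrite eq_complex /=.
by apply/andP; split; apply/eqP; ring.
Qed.

Lemma nrm_conj z : nrm (conjc z) = nrm z.
Proof.
apply/eqP; rewrite -(@eqrXn2 _ 2)// ?nrm_ge0// !sqr_nrm; case: z => a b /=.
by rewrite sqrrN.
Qed.

Lemma norm_Re_le z : `|complex.Re z| <= nrm z.
Proof.
rewrite -(@ler_pXn2r _ 2) ?nnegrE ?nrm_ge0// sqr_nrm real_normK ?num_real//.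
by rewrite lerDl sqr_ge0.
Qed.

Lemma norm_Im_le z : `|complex.Im z| <= nrm z.
Proof.
rewrite -(@ler_pXn2r _ 2) ?nnegrE ?nrm_ge0// sqr_nrm real_normK ?num_real//.
by rewrite lerDr sqr_ge0.
Qed.

Lemma nrm_le_ReIm z : nrm z <= `|complex.Re z| + `|complex.Im z|.
Proof.
rewrite -(@ler_pXn2r _ 2) ?nnegrE ?nrm_ge0 ?addr_ge0// sqr_nrm sqrrD.
rewrite !real_normK ?num_real// addrAC lerDl.
by rewrite mulrn_wge0// mulr_ge0.
Qed.

Lemma sqr_nrmB z w : nrm (z - w) ^+ 2 =
  nrm z ^+ 2 + nrm w ^+ 2 - 2 * complex.Re (w * conjc z).
Proof. by rewrite !sqr_nrm; case: z w => a b [c d] /=; ring. Qed.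

End complex_nrm.

Section convergence.
Variables (R : realType) (T : Type) (F : set_system T).
Context {FF : Filter F}.

Lemma cvg_nrmP (V : normedModType R[i]) (u : T -> V) (l : V) :
  (u @ F --> l) <-> forall e : R, 0 < e -> \forall x \near F, nrm (l - u x) < e.
Proof.
split=> [/cvgrPdist_lt h e e0|h].
  have := h e%:C; rewrite ltcR => /(_ e0); apply: filterS => x /=.
  by rewrite nrmE ltcR.
apply/cvgrPdist_lt => e e0; have := h (complex.Re e).
have ee : (complex.Re e)%:C = e by rewrite ge0_ReK// ltW.
rewrite -ltcR ee => /(_ e0); apply: filterS => x /=.
by rewrite -ltcR -nrmE ee.
Qed.

Lemma cvg_Re (u : T -> R[i]) (l : R[i]) :
  u @ F --> l -> (fun x => complex.Re (u x)) @ F --> complex.Re l.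
Proof.
move=> /cvg_nrmP h; apply/cvgrPdist_lt => e /h; apply: filterS => x.
by apply: le_lt_trans; rewrite -raddfB norm_Re_le.
Qed.

Lemma cvg_complex (u : T -> R[i]) (a b : R) :
  (fun x => complex.Re (u x)) @ F --> a -> (fun x => complex.Im (u x)) @ F --> b ->
  u @ F --> (a +i* b).
Proof.
move=> /cvgrPdist_lt ha /cvgrPdist_lt hb; apply/cvg_nrmP => e e0.
have e2 : 0 < e / 2 by rewrite divr_gt0.
near=> x; apply: (le_lt_trans (nrm_le_ReIm _)).
rewrite (splitr e) !raddfB /=; apply: ltrD; near: x; [exact: ha|exact: hb].
Unshelve. all: by end_near. Qed.

Lemma cvg_nrm (V : normedModType R[i]) (u : T -> V) (l : V) :
  u @ F --> l -> (fun x => nrm (u x)) @ F --> nrm l.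
Proof. by move=> ul; apply: cvg_Re; exact: cvg_norm. Qed.

Lemma cvg_nrm0P (V : normedModType R[i]) (u : T -> V) (l : V) :
  (u @ F --> l) <-> ((fun x => nrm (u x - l)) @ F --> (0 : R)).
Proof.
split=> [/cvg_nrmP h|/cvgrPdist_lt h].
  apply/cvgrPdist_lt => e /h; apply: filterS => x.
  by rewrite sub0r normrN ger0_norm ?nrm_ge0// nrm_distC.
apply/cvg_nrmP => e /h; apply: filterS => x.
by rewrite sub0r normrN ger0_norm ?nrm_ge0// nrm_distC.
Qed.

End convergence.

Section ultralimits.
Variables (T : Type) (U : set_system T).
Context {UU : UltraFilter U}.

Lemma ultra_fmap (S : Type) (f : T -> S) : UltraFilter (f @ U).
Proof.
split; first exact: fmap_proper_filter.
move=> G GF fUG; apply/seteqP; split=> [A GA|]; last exact: fUG.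
have [//|nA] := in_ultra_setVsetC (f @^-1` A) UU.
have /filter_ex[x []//] : G (A `&` ~` A) by apply: filterI => //; exact: fUG.
Qed.

Variable R : realType.

Lemma ultra_cvg (u : T -> R) (B : R) : (forall x, `|u x| <= B) -> cvg (u @ U).
Proof.
move=> uB; have := @segment_compact R (- B) B.
rewrite compact_ultra => /(_ (u @ U) (ultra_fmap u)) [|l [_ ul]].
  have : \forall x \near U, u x \in `[- B, B].
    by apply: filterE => x; rewrite in_itv /= -ler_norml.
  exact.
by apply/cvg_ex; exists l.
Qed.

Lemma ultra_cvgC (u : T -> R[i]) (B : R) :
  (forall x, nrm (u x) <= B) -> cvg (u @ U).
Proof.
move=> uB.
have /cvg_ex[a ua] : cvg ((fun x => complex.Re (u x)) @ U).
  by apply: (@ultra_cvg _ B) => x; rewrite (le_trans (norm_Re_le _)).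
have /cvg_ex[b ub] : cvg ((fun x => complex.Im (u x)) @ U).
  by apply: (@ultra_cvg _ B) => x; rewrite (le_trans (norm_Im_le _)).
by apply/cvg_ex; exists (a +i* b); exact: cvg_complex.
Qed.

Lemma cvg_unique_complex (u : T -> R[i]) (a b : R[i]) :
  u @ U --> a -> u @ U --> b -> a = b.
Proof. by apply: cvg_unique; exact: norm_hausdorff. Qed.

Lemma le_nrm_cvg (V : normedModType R[i]) (u : T -> V) (l : V) (B : R) :
  u @ U --> l -> (\forall x \near U, nrm (u x) <= B) -> nrm l <= B.
Proof. by move=> /cvg_nrm; exact: cvgr_to_le. Qed.

End ultralimits.

(** * Finite Fourier analysis *)

Section fourier.
Variable R : realType.
Local Notation C := R[i].

(** ['X^n - 1] is separable in characteristic 0, hence has n distinct roots, and n distinct n-th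
    roots of unity include a primitive one. *)
Lemma prim_root_complex_exists n : (0 < n)%N -> exists z : C, n.-primitive_root z.
Proof.
move=> n_gt0; pose p : {poly C} := 'X^n - 1.
have [r Dp] := closed_field_poly_normal p.
rewrite (monicP _) ?monicXnsubC // scale1r in Dp.
have rn1: all n.-unity_root r by apply/allP=> z; rewrite -root_prod_XsubC -Dp.
have sz_r: (n < (size r).+1)%N.
  by rewrite -(size_prod_XsubC r id) -Dp size_XnsubC.
have [|z] := hasP (cyclic.has_prim_root n_gt0 rn1 _ sz_r); last by exists z.
rewrite -separable.separable_prod_XsubC -Dp cyclotomic.separable_Xn_sub_1//.
by rewrite pnatr_eq0 -lt0n.
Qed.

Variables (L : nat) (z : C).
Hypothesis zL : L.-primitive_root z.

Lemma nrm_prim_root : nrm z = 1.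
Proof.
have L0 := prim_order_gt0 zL.
apply/eqP; rewrite -(@eqrXn2 _ L) ?nrm_ge0//.
by rewrite -nrmX (prim_expr_order zL) expr1n (nrm_real 1) normr1.
Qed.

Lemma prim_root_orthogonal m n : (m < L)%N -> (n < L)%N ->
  \sum_(j < L) z ^+ (j * m) * conjc z ^+ (j * n) = if m == n then L%:R else 0.
Proof.
move=> mL nL.
have zc : z * conjc z = 1 by rewrite mulcJ nrm_prim_root expr1n.
have [->|mn] := eqVneq m n.
  under eq_bigr do rewrite -exprMn zc expr1n.
  by rewrite sumr_const card_ord.
(* The ratio of a geometric progression: [x ^+ L = 1] and [x != 1] make the sum vanish. *)
pose x := z ^+ m * conjc z ^+ n.
under eq_bigr do rewrite mulnC [(_ * n)%N]mulnC !exprM -exprMn -/x.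
have xL : x ^+ L = 1.
  by rewrite exprMn -!exprM mulnC exprM mulnC [X in _ * X]exprM (prim_expr_order zL)
    expr1n mul1r -rmorphXn /= (prim_expr_order zL) conjc1 expr1n.
have x1 : x - 1 != 0.
  apply: contra mn; rewrite subr_eq0 => /eqP x1.
  have : z ^+ m == z ^+ n.
    have : z ^+ n * x = z ^+ n by rewrite x1 mulr1.
    by rewrite /x mulrCA -exprMn zc expr1n mulr1 => ->.
  by rewrite (eq_prim_root_expr zL) !modn_small.
by apply: (mulfI x1); rewrite -subrX1 xL subrr mulr0.
Qed.

Lemma parseval (v : nat -> C) :
  \sum_(w < L) nrm (\sum_(j < L) v j * z ^+ (w * j)) ^+ 2 =
  L%:R * \sum_(j < L) nrm (v j) ^+ 2.
Proof.
apply: (@complexI R); rewrite rmorphM /= !rmorph_sum /= rmorph_nat.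
under eq_bigr do rewrite -mulcJ rmorph_sum big_distrlr /=.
rewrite exchange_big /= mulr_sumr; apply: eq_bigr => j _.
rewrite exchange_big /= (bigD1 j)//= [X in _ + X]big1 ?addr0; last first.
  move=> i ij.
  under eq_bigr do rewrite rmorphM rmorphXn /= mulrACA.
  by rewrite -mulr_sumr prim_root_orthogonal// val_eqE eq_sym (negbTE ij) mulr0.
under eq_bigr do rewrite rmorphM rmorphXn /= mulrACA.
by rewrite -mulr_sumr prim_root_orthogonal// eqxx mulcJ mulrC.
Qed.

End fourier.

(* With [P] and [Q] the discrete Fourier transforms of [a] and [b] on
   [Z/2S], the inner sum is the inverse transform of [P Q]. *)
Lemma correlation_bound (R : realType) (S : nat) (a b : nat -> R[i]) (M : R) :
  (forall z : R[i], nrm z = 1 -> nrm (\sum_(n < S + S) a n * z ^+ n) <= M) ->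
  \sum_(w < S) nrm (\sum_(k < S) b k * a (w + k)%N) ^+ 2 <=
  M ^+ 2 * \sum_(k < S) nrm (b k) ^+ 2.
Proof.
move=> aM; have [->|S0] := posnP S; first by rewrite !big_ord0 mulr0.
(* In a cyclic group of order 2S the index w + k, with w and k below S, does not wrap around: the
   cyclic correlation with [b] padded by zeros is the plain one. *)
set L := (S + S)%N in aM *.
have L0 : (0 < L)%N by rewrite addn_gt0 S0.
have [z zL] := prim_root_complex_exists R L0.
have L0' : (L%:R : R) != 0 by rewrite pnatr_eq0 -lt0n.
pose P j := \sum_(n < L) a n * conjc (z ^+ j) ^+ n.
pose b' k := if (k < S)%N then b k else 0.
pose Q j := \sum_(k < L) b' k * z ^+ (j * k).
pose v j := L%:R^-1 * (P j * Q j).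
have vE w : (w < S)%N -> \sum_(j < L) v j * z ^+ (w * j) =
    \sum_(k < S) b k * a (w + k)%N.
  move=> wS.
  transitivity (\sum_(k < L) b' k * a (w + k)%N); last first.
    rewrite big_split_ord /= [X in _ + X]big1 ?addr0; last first.
      by move=> i _; rewrite /b' ltnNge leq_addr /= mul0r.
    by apply: eq_bigr => i _; rewrite /b' ltn_ord.
  transitivity (L%:R^-1 * \sum_(j < L) \sum_(k < L) \sum_(n < L)
      (b' k * a n) * (z ^+ (j * (w + k)) * conjc z ^+ (j * n))).
    rewrite mulr_sumr; apply: eq_bigr => j _.
    rewrite /v -!mulrA; congr (_ * _); rewrite /P /Q mulrA -mulrA mulrC.
    rewrite mulr_suml mulr_suml; apply: eq_bigr => k _.
    rewrite mulr_sumr; apply: eq_bigr => n _.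
    rewrite rmorphXn /= -exprM mulnDr exprD [(j * w)%N]mulnC; ring.
  rewrite exchange_big /= mulr_sumr; apply: eq_bigr => k _.
  rewrite exchange_big /= /b'; case: ifPn => kS; last first.
    rewrite mul0r big1 ?mulr0// => n _; rewrite big1// => j _.
    by rewrite !mul0r.
  have wkL : (w + k < L)%N by rewrite /L -addSn leq_add// ltnW.
  rewrite (bigD1 (Ordinal wkL))//= [X in _ + X]big1 ?addr0; last first.
    move=> n nwk; rewrite -mulr_sumr prim_root_orthogonal//.
    have /negbTE -> : (w + k)%N != n.
      by apply: contra nwk => /eqP e; apply/eqP/val_inj; rewrite /= e.
    by rewrite mulr0.
  by rewrite -mulr_sumr prim_root_orthogonal// eqxx mulrC mulfK// pnatr_eq0 -lt0n.
have -> : \sum_(k < S) nrm (b k) ^+ 2 = \sum_(k < L) nrm (b' k) ^+ 2.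
  rewrite big_split_ord /= [X in _ = _ + X]big1 ?addr0; last first.
    by move=> i _; rewrite /b' ltnNge leq_addr /= nrm0 expr0n.
  by apply: eq_bigr => i _; rewrite /b' ltn_ord.
apply: (@le_trans _ _ (\sum_(w < L) nrm (\sum_(j < L) v j * z ^+ (w * j)) ^+ 2)).
  rewrite [leRHS]big_split_ord /= -[leLHS]addr0 lerD//.
    by apply: ler_sum => w _; rewrite vE.
  by apply: sumr_ge0 => w _; rewrite sqr_ge0.
rewrite (parseval zL).
apply: (@le_trans _ _ (L%:R * \sum_(j < L) (L%:R^-1 ^+ 2 * M ^+ 2) * nrm (Q j) ^+ 2)).
  rewrite ler_wpM2l//; apply: ler_sum => j _.
  rewrite /v !nrmM !exprMn -mulrA.
  have -> : nrm (L%:R^-1 : R[i]) = L%:R^-1.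
    by rewrite -(rmorph_nat (real_complex R)) -fmorphV /= nrm_real ger0_norm.
  rewrite ler_wpM2l ?sqr_ge0// ler_wpM2r ?sqr_ge0//.
  rewrite ler_pXn2r ?nnegrE ?nrm_ge0//; last first.
    by rewrite (le_trans (nrm_ge0 _) (aM 1 _))// (nrm_real 1) normr1.
  by apply: aM; rewrite nrm_conj nrmX (nrm_prim_root zL) expr1n.
rewrite -mulr_sumr (parseval zL).
rewrite [leLHS](_ : _ = M ^+ 2 * \sum_(k < L) nrm (b' k) ^+ 2)//.
by field.
Qed.

(** * Dominated convergence for finitely additive means *)

Definition bounded_by (R : realType) (T : Type) (B : R) (g : T -> R) :=
  forall t, `|g t| <= B.

Definition bounded_real (R : realType) (T : Type) (g : T -> R) :=
  exists B, bounded_by B g.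

Record is_mean (R : realType) (T : Type) (m : (T -> R) -> R) : Prop := IsMean {
  meanD : forall f g, bounded_real f -> bounded_real g ->
    m (fun t => f t + g t) = m f + m g;
  meanZ : forall c f, bounded_real f -> m (fun t => c * f t) = c * m f;
  mean_le : forall f g, bounded_real f -> bounded_real g ->
    (forall t, f t <= g t) -> m f <= m g;
  mean1 : m (fun=> 1) = 1 }.

Section bounded_real_theory.
Variables (R : realType) (T : Type).
Implicit Types f g : T -> R.

Lemma bounded_realD f g : bounded_real f -> bounded_real g ->
  bounded_real (fun t => f t + g t).
Proof.
by move=> [B fB] [B' gB]; exists (B + B') => t; rewrite (le_trans (ler_normD _ _))// lerD.
Qed.

Lemma bounded_realM f g : bounded_real f -> bounded_real g ->
  bounded_real (fun t => f t * g t).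
Proof.
move=> [B fB] [B' gB]; exists (B * B') => t; rewrite normrM.
by rewrite ler_pM.
Qed.

Lemma bounded_real_const (c : R) : bounded_real (fun _ : T => c).
Proof. by exists `|c| => t. Qed.

Lemma bounded_real_itv (a b : R) f : (forall t, a <= f t <= b) -> bounded_real f.
Proof.
move=> fab; exists (`|a| + `|b|) => t; have /andP[af fb] := fab t.
have := ler_norm b; have := ler_norm (- a); rewrite normrN => ? ?.
by rewrite ler_norml; apply/andP; split; have := normr_ge0 a; have := normr_ge0 b; lra.
Qed.

End bounded_real_theory.

Section finitely_additive_mean.
Variables (R : realType) (T : Type) (m : (T -> R) -> R).
Hypothesis mm : is_mean m.
Variables (W : set_system nat).
Context {WU : UltraFilter W}.

Lemma ultra_not (P : nat -> Prop) :
  ~ (\forall n \near W, P n) -> \forall n \near W, ~ P n.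
Proof. by have [|] := in_ultra_setVsetC P WU. Qed.

(** The weight [p] will be a product of functions [g n] already chosen. Being correlated means that
    W-almost every [g n] can still be appended, with a mean bounded away from 0. *)
Definition correlated (g : nat -> T -> R) (p : T -> R) :=
  exists2 l : R, 0 < l & \forall n \near W, l <= m (fun t => p t * g n t).

(* Otherwise sums [q] of [K] suitable [g n] would be nearly orthogonal, so that
   [m (p q)] grows like [K] while [m (p q^2)] is at most [2 K]. *)
Lemma correlated_mul (g : nat -> T -> R) (p : T -> R) :
  (forall n t, 0 <= g n t <= 1) -> (forall t, 0 <= p t <= 1) ->
  correlated g p -> \forall n \near W, correlated g (fun t => p t * g n t).
Proof.
move=> g01 p01 [l l0 pl]; apply: contrapT => /ultra_not nc.
have bg n : bounded_real (g n) by exact: bounded_real_itv.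
have bp : bounded_real p by exact: bounded_real_itv.
have small n : ~ correlated g (fun t => p t * g n t) -> forall e, 0 < e ->
    \forall k \near W, m (fun t => p t * g n t * g k t) < e.
  move=> nck e e0; have : ~ \forall k \near W, e <= m (fun t => p t * g n t * g k t).
    by move=> h; apply: nck; exists e.
  by move=> /ultra_not; apply: filterS => k /negP; rewrite -ltNge.
have step (K : nat) : exists q : T -> R, [/\ bounded_real q,
    forall e, 0 < e -> \forall k \near W, m (fun t => p t * q t * g k t) < e,
    K%:R * l <= m (fun t => p t * q t) &
    m (fun t => p t * q t ^+ 2) <= 2 * K%:R].
  elim: K => [|K [q [bq qs ql q2]]].
    have m0 : m (fun t => 0 * p t) = 0 by rewrite (meanZ mm)// mul0r.
    exists (fun=> 0); split=> [|e e0||].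
    - exact: bounded_real_const.
    - apply: filterE => k; rewrite (_ : (fun t => _) = (fun t => 0 * p t)) ?m0//.
      by apply: funext => t; rewrite mulr0 !mul0r.
    - rewrite mul0r (_ : (fun t => _) = (fun t => 0 * p t)) ?m0//.
      by apply: funext => t; rewrite mulr0 mul0r.
    - rewrite mulr0 (_ : (fun t => _) = (fun t => 0 * p t)) ?m0//.
      by apply: funext => t; rewrite expr0n mulr0 mul0r.
  (* The threshold 1/2 keeps the cross term 2 m(p q g_n) below 1, and the diagonal term m(p g_n^2)
     is at most 1: hence the growth by 2 per step in the last clause. *)
  have [n [ncn [ln qn]]] : exists n, ~ correlated g (fun t => p t * g n t) /\
      (l <= m (fun t => p t * g n t) /\ m (fun t => p t * q t * g n t) < 2^-1).
    apply: (@filter_ex _ W); apply: filterI => //; apply: filterI => //.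
    by apply: qs; rewrite invr_gt0.
  have bpq := bounded_realM bp bq.
  have bpg := bounded_realM bp (bg n).
  exists (fun t => q t + g n t); split.
  - exact: bounded_realD.
  - move=> e e0; have e2 : 0 < e / 2 by rewrite divr_gt0.
    near=> k.
    rewrite (_ : (fun t => _) =
      (fun t => (p t * q t * g k t) + (p t * g n t * g k t))); last first.
      by apply: funext => t; ring.
    rewrite (meanD mm); [|exact: bounded_realM|exact: bounded_realM].
    rewrite (splitr e); apply: ltrD; near: k; first exact: qs.
    exact: small.
  - rewrite (_ : (fun t => _) = (fun t => (p t * q t) + (p t * g n t))); last first.
      by apply: funext => t; ring.
    by rewrite (meanD mm)// -[K.+1%:R]natr1 mulrDl mul1r lerD.
  - have bq2 : bounded_real (fun t => p t * q t ^+ 2).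
      by under eq_fun do rewrite expr2 mulrA; exact: bounded_realM.
    have bpqg := bounded_realM bpq (bg n).
    have bpgg := bounded_realM bpg (bg n).
    have b2 := bounded_realM (bounded_real_const T 2) bpqg.
    rewrite (_ : (fun t => _) = (fun t => (p t * q t ^+ 2 +
       (2 * (p t * q t * g n t))) + p t * g n t * g n t)); last first.
      by apply: funext => t; ring.
    rewrite (meanD mm)//; last exact: bounded_realD.
    rewrite (meanD mm)// (meanZ mm)//.
    have : m (fun t => p t * g n t * g n t) <= 1.
      rewrite -(mean1 mm); apply: (mean_le mm) => //; first exact: bounded_real_const.
      move=> t; have /andP[? ?] := g01 n t; have /andP[? ?] := p01 t.
      by rewrite mulr_ile1 ?mulr_ile1 ?mulr_ge0.
    move: qn q2; rewrite -[K.+1%:R]natr1; lra.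
(* With a = K l, the inequality q <= a/2 + q^2/(2a) will give a <= a/2 + 1/l, that is K <= 2/l^2,
   against this choice of K. *)
have [q [bq _ ql q2]] := step (Num.bound (2 / l ^+ 2)).
set K := Num.bound _ in ql q2.
have Kl : 2 / l ^+ 2 < K%:R by rewrite archi_boundP// divr_ge0// sqr_ge0.
have K0 : 0 < K%:R :> R by rewrite (le_lt_trans _ Kl)// divr_ge0// sqr_ge0.
pose a := K%:R * l.
have a0 : 0 < a by rewrite mulr_gt0.
have bq2 : bounded_real (fun t => p t * q t ^+ 2).
  by under eq_fun do rewrite expr2 mulrA; apply: bounded_realM => //; exact: bounded_realM.
have : m (fun t => p t * q t) <= a / 2 + (2 * a)^-1 * m (fun t => p t * q t ^+ 2).
  have bc : bounded_real (fun _ : T => a / 2 * 1) by exact: bounded_real_const.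
  have bq2' : bounded_real (fun t => (2 * a)^-1 * (p t * q t ^+ 2)).
    by apply: bounded_realM => //; exact: bounded_real_const.
  have -> : a / 2 + (2 * a)^-1 * m (fun t => p t * q t ^+ 2) =
      m (fun t => a / 2 * 1 + (2 * a)^-1 * (p t * q t ^+ 2)).
    rewrite (meanD mm)// !(meanZ mm)// ?(mean1 mm) ?mulr1//.
    exact: bounded_real_const.
  apply: (mean_le mm); [exact: bounded_realM|exact: bounded_realD|move=> t].
  have /andP[p0 p1] := p01 t.
  have : 0 <= (2 * a)^-1 * (p t * (q t - a) ^+ 2).
    apply: mulr_ge0; first by rewrite invr_ge0 ltW// mulr_gt0.
    by apply: mulr_ge0 => //; exact: sqr_ge0.
  have -> : (2 * a)^-1 * (p t * (q t - a) ^+ 2) =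
    (2 * a)^-1 * (p t * q t ^+ 2) - p t * q t + p t * (a / 2).
    by field; rewrite gt_eqF.
  have : p t * (a / 2) <= a / 2 * 1.
    by rewrite mulrC ler_wpM2l// divr_ge0// ltW.
  lra.
move=> h.
have : a <= a / 2 + (2 * a)^-1 * (2 * K%:R).
  apply: (le_trans ql); apply: (le_trans h).
  by rewrite lerD2l ler_wpM2l// invr_ge0 mulr_ge0// ltW.
have -> : (2 * a)^-1 * (2 * K%:R) = l^-1.
  by rewrite /a; field; rewrite !gt_eqF.
have : a / 2 > l^-1.
  have -> : l^-1 = (2 / l ^+ 2) * l / 2 by field; rewrite gt_eqF.
  by rewrite ltr_pM2r// ltr_pM2r.
lra.
Unshelve. all: by end_near. Qed.

(* A finitely additive substitute for the dominated convergence theorem: the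
   sequences [nn] and [tt] violate an interchange of iterated limits. *)
Lemma mean_dominated_convergence (u : nat -> T -> R) (B c : R) : 0 < c ->
  (forall n t, 0 <= u n t <= B) -> (forall t, u n t @[n --> W] --> 0) ->
  (forall n, 2 * c <= m (u n)) ->
  exists nn tt, (forall j k, (j <= k)%N -> c <= u (nn j) (tt k)) /\
    forall k, u (nn j) (tt k) @[j --> \oo] --> 0.
Proof.
move=> c0 u0B u0 cu.
pose D := `|B| + 1; have D0 : 0 < D by rewrite ltr_wpDl.
(* Cutting at height c makes positivity of [g n t] imply [c <= u n t] and costs at most c of the
   mean 2c; division by D brings the values into [0, 1]. *)
pose g n t := D^-1 * Num.max (u n t - c) 0.
have g01 n t : 0 <= g n t <= 1.
  have /andP[u0' uB] := u0B n t; rewrite /g mulr_ge0 ?invr_ge0 ?le_max ?lexx ?orbT ?(ltW D0)//=.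
  rewrite mulrC ler_pdivrMr// mul1r ge_max /D; have := ler_norm B; have := normr_ge0 B.
  by move=> ? ?; apply/andP; split; lra.
have bg n : bounded_real (g n) by exact: bounded_real_itv.
have bu n : bounded_real (u n) by exact: bounded_real_itv.
have b1 (d : R) : bounded_real (fun _ : T => d) := bounded_real_const T d.
have gE n t : 0 < g n t -> c <= u n t.
  rewrite /g pmulr_rgt0 ?invr_gt0// lt_max ltxx orbF subr_gt0; exact: ltW.
have mg n : D^-1 * c <= m (g n).
  apply: (@le_trans _ _ (m (fun t => D^-1 * (u n t + (- c) * 1)))).
    rewrite (meanZ mm); last by apply: bounded_realD => //; exact: b1.
    rewrite (meanD mm)//.
    rewrite (meanZ mm)// (mean1 mm) ler_wpM2l ?invr_ge0 ?(ltW D0)//.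
    by have := cu n; lra.
  apply: (mean_le mm) => //.
    by apply: bounded_realM; [exact: b1|apply: bounded_realD => //; exact: b1].
  by move=> t; rewrite /g ler_wpM2l ?invr_ge0 ?(ltW D0)// mulr1 le_max lexx.
(* State: product of the chosen [g n], set of the chosen points, number of steps. The last clause is
   what finiteness of that set provides: pointwise convergence is uniform on it. *)
pose inv (s : (T -> R) * set T * nat) :=
  [/\ forall t, 0 <= s.1.1 t <= 1, correlated g s.1.1 &
    forall e, 0 < e -> \forall n \near W, forall t, s.1.2 t -> u n t <= e].
(* At the new point the whole product is positive, so every index chosen so far takes a value at
   least c there; the new index is nearly 0 at all earlier points. These are the two halves of the
   conclusion. *)
pose next (s s' : (T -> R) * set T * nat) (n : nat) (t : T) :=
  [/\ s'.1.1 = (fun t => s.1.1 t * g n t), 0 < s'.1.1 t,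
    s'.1.2 = s.1.2 `|` [set t], s'.2 = s.2.+1 &
    forall t0, s.1.2 t0 -> u n t0 <= s.2.+1%:R^-1].
have step (s : {s | inv s}) : {s' : {s | inv s} | exists nt : nat * T,
    next (sval s) (sval s') nt.1 nt.2}.
  case: s => -[[p E] k] [/= p01 pc Es]; apply: cid.
  have k0 : 0 < k.+1%:R^-1 :> R by rewrite invr_gt0.
  have [l l0 lp] := pc.
  have [n [nc [ln nE]]] : exists n, correlated g (fun t => p t * g n t) /\
      (l <= m (fun t => p t * g n t) /\ forall t, E t -> u n t <= k.+1%:R^-1).
    apply: (@filter_ex _ W); apply: filterI; first exact: correlated_mul.
    by apply: filterI => //; exact: Es.
  have [t pt] : exists t, 0 < p t * g n t.
    apply: contrapT => /forallNP h; move: ln; apply/negP; rewrite -ltNge.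
    apply: le_lt_trans l0.
    have -> : 0 = m (fun t => 0 * p t).
      by rewrite (meanZ mm) ?mul0r//; exact: bounded_real_itv.
    apply: (mean_le mm).
    - by apply: bounded_realM => //; exact: bounded_real_itv.
    - by apply: bounded_realM; [exact: b1|exact: bounded_real_itv].
    - by move=> t; rewrite mul0r leNgt; apply/negP/h.
  have invs' : inv ((fun t => p t * g n t), E `|` [set t], k.+1).
    split=> /= [t0||e e0] //.
      have /andP[? ?] := p01 t0; have /andP[? ?] := g01 n t0.
      by rewrite mulr_ge0// mulr_ile1.
    near=> n0 => t0 [|->]; first by move: t0; near: n0; exact: Es.
    near: n0; have /cvgrPdist_le/(_ e e0) := u0 t; apply: filterS => n0.
    by rewrite sub0r normrN => /(le_trans (ler_norm _)).
  by exists (exist _ _ invs'), (n, t); split.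
have inv0 : inv ((fun=> 1), set0, 0%N).
  split=> /= [t||e e0]; first by rewrite ler01 lexx.
    exists (D^-1 * c); first by rewrite mulr_gt0 ?invr_gt0.
    by apply: filterE => n; under eq_fun do rewrite mul1r.
  by apply: filterE => n t.
have [f [f0 fS]] := dependent_choice step (exist _ _ inv0).
have [nt ntP] := choice fS.
exists (fun k => (nt k).1), (fun k => (nt k).2).
have fk k : (sval (f k)).2 = k.
  by elim: k => [|k ih]; [rewrite f0|have [_ _ _ -> _] := ntP k; rewrite ih].
have fE k j : (k < j)%N -> (sval (f j)).1.2 (nt k).2.
  elim: j => // j ih; rewrite ltnS leq_eqVlt => /orP[/eqP ->|kj].
    by have [_ _ -> _ _] := ntP j; right.
  by have [_ _ -> _ _] := ntP j; left; exact: ih.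
have p0 j t : 0 <= (sval (f j)).1.1 t.
  by have [/(_ t)/andP[]] := svalP (f j).
have fp k j t : (j < k)%N -> 0 < (sval (f k)).1.1 t -> 0 < g (nt j).1 t.
  elim: k => // k ih; have [-> _ _ _ _] := ntP k.
  have /andP[g0 _] := g01 (nt k).1 t.
  move=> jk pg; have : (sval (f k)).1.1 t != 0 /\ g (nt k).1 t != 0.
    by apply/andP; rewrite -negb_or -mulf_eq0 gt_eqF.
  move=> -[pk gk]; move: jk; rewrite ltnS leq_eqVlt => /orP[/eqP ->|jk].
    by rewrite lt0r gk.
  by apply: ih => //; rewrite lt0r pk p0.
split=> [j k jk|k].
  by apply/gE/(@fp k.+1) => //; have [_ pk _ _ _] := ntP k.
apply/cvgrPdist_le => e e0; near=> j.
rewrite sub0r normrN ger0_norm; last by have /andP[] := u0B (nt j).1 (nt k).2.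
have [_ _ _ _ h] := ntP j.
have kj : (k < j)%N by near: j; exact: nbhs_infty_gt.
apply: (le_trans (h _ (fE _ _ kj))); rewrite fk ltW//.
by near: j; exact: near_infty_natSinv_lt (PosNum e0).
Unshelve. all: by end_near. Qed.

End finitely_additive_mean.

(** * Weak limits of translates *)

(** A shift by one changes the sum only by its two end terms, at most 2 B in norm, and [p] such
    shifts add up. *)
Lemma shift_sum_bound (R : realType) (a : nat -> R[i]) (B : R) (M p : nat) :
  (forall n, nrm (a n) <= B) ->
  nrm (\sum_(n < M) a (n + p)%N - \sum_(n < M) a n) <= 2 * p%:R * B.
Proof.
move=> aB; elim: p => [|p ih].
  under eq_bigr do rewrite addn0.
  by rewrite subrr nrm0 mulr0 mul0r.
have -> : \sum_(n < M) a (n + p.+1)%N - \sum_(n < M) a n =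
    (a (M + p)%N - a p) + (\sum_(n < M) a (n + p)%N - \sum_(n < M) a n).
  rewrite addrA; congr (_ - _); apply/eqP; rewrite -subr_eq -sumrB.
  rewrite (eq_bigr (fun n : 'I_M => a (n.+1 + p)%N - a (n + p)%N)); last first.
    by move=> n _; rewrite addnS.
  rewrite -(big_mkord xpredT (fun n => a (n.+1 + p)%N - a (n + p)%N)).
  by rewrite (telescope_sumr (fun n => a (n + p)%N)).
rewrite (le_trans (nrmD _ _))// -[p.+1%:R]natr1 mulrDr mulrDl [leRHS]addrC.
rewrite lerD// (le_trans (nrmB _ _))// mulr1 mulr2n mulrDl mul1r.
exact: lerD.
Qed.

Section bounded_functionals.
Variables (R : realType) (V : normedModType R[i]).

Lemma bounded_functional (f : V -> R[i]) (B : R) : linear f ->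
  (forall v, nrm (f v) <= B * nrm v) -> exists g : dual V, g = f :> (V -> R[i]).
Proof.
move=> lf fB; have fV : f \in @bop_pred R V R[i].
  rewrite inE; split=> // v; apply/cvg_nrmP => e e0.
  have B0 : 0 < `|B| + 1 by rewrite ltr_wpDl.
  have /cvg_nrmP/(_ (e / (`|B| + 1))) h : (id : V -> V) @ v --> v by exact: cvg_id.
  have e1 : 0 < e / (`|B| + 1) by rewrite divr_gt0.
  near=> w.
  have -> : f v - f w = f (v - w).
    by rewrite -[v - w]addrC -(scaleN1r w) lf scaleN1r addrC.
  apply: (le_lt_trans (fB _)); apply: (@le_lt_trans _ _ ((`|B| + 1) * nrm (v - w))).
    by rewrite ler_wpM2r ?nrm_ge0// (le_trans (ler_norm _))// lerDl.
  by rewrite mulrC -ltr_pdivlMr//; near: w; exact: h.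
by exists (Bop fV).
Unshelve. all: by end_near. Qed.

Lemma dual_nrm_ub (g : dual V) : exists2 B : R, 0 <= B &
  forall v, nrm (g v) <= B * nrm v.
Proof.
have [M M0 gM] := bop_bounded g; exists (complex.Re M).
  by rewrite -lecR ge0_ReK.
by move=> v; rewrite -lecR rmorphM /= -!nrmE ge0_ReK.
Qed.

(** Banach-Alaoglu along an ultrafilter: the values at each vector are bounded, hence converge, and
    the limits inherit linearity and the bound. *)
Lemma ultralimit_functional (T : Type) (U : set_system T) (UU : UltraFilter U)
    (f : T -> V -> R[i]) (B : R) : (forall n, linear (f n)) ->
  (forall n v, nrm (f n v) <= B * nrm v) ->
  exists g : dual V, forall v, f n v @[n --> U] --> g v.
Proof.
move=> lf fB; pose l v := lim (f n v @[n --> U]).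
have fl v : f n v @[n --> U] --> l v by exact: (@ultra_cvgC _ _ _ _ _ (B * nrm v)).
have [||g gE] := @bounded_functional l B.
- move=> a u v; apply: (@cvg_unique_complex _ _ _ _ (fun n => f n (a *: u + v))).
    exact: fl.
  have : (fun n => a *: f n u + f n v) @ U --> a *: l u + l v.
    by apply: cvgD; [apply: cvgZr|]; exact: fl.
  by apply: cvg_trans; apply: near_eq_cvg; apply: filterE => n; rewrite lf.
- by move=> v; apply: (le_nrm_cvg (fl v)); apply: filterE.
by exists g => v; rewrite gE.
Qed.

End bounded_functionals.

Section weak_limits.
Variables (R : realType).
Local Notation H := (halfline R).
Local Notation C := R[i].

Lemma weak_eval_cvg (V : normedModType C) (T : Type) (W : set_system T)
    {FW : Filter W} (u : T -> V) (h : V) (phi : dual V) :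
  (u : T -> weak V) @ W --> (h : weak V) -> phi (u n) @[n --> W] --> phi h.
Proof.
move=> uh.
pose ev : weak V -> {ptws dual V -> C} := fun v phi => phi v.
have evc : continuous ev by exact: initial_continuous.
have : (fun n => ev (u n)) @ W --> ev h.
  by apply: (cvg_comp _ _ uh); exact: evc.
by move=> /pointwise_cvgP /(_ phi).
Qed.

(** The translates lie in a weakly compact set, where every ultrafilter converges; the limit along
    [W] takes the place of a weakly convergent subsequence. *)
Lemma translate_weak_limit (F : cb R H)
    (Fwap : precompact ([set translate tau F | tau in [set: H]] : set (weak (cb R H))))
    (s : nat -> H) (W : set_system nat) (WU : UltraFilter W) :
  exists h : cb R H, forall phi : dual (cb R H),
    phi (translate (s n) F) @[n --> W] --> phi h.
Proof.
have [K FK [cK _]] := Fwap; move: cK; rewrite compact_ultra.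
move=> /(_ _ (ultra_fmap (fun n => translate (s n) F : weak (cb R H))))[].
  have : \forall n \near W, K (translate (s n) F).
    by apply: filterE => n; apply: FK; exists (s n).
  exact.
by move=> h [_ hh]; exists h => phi; exact: weak_eval_cvg.
Qed.

Lemma nrm_supnorm (g : cb R H) t : nrm (g t) <= nrm g.
Proof. by rewrite -lecR -!nrmE; exact: supnorm_ub. Qed.

Lemma ultra_at_infty : exists2 U : set_system nat, UltraFilter U & \oo `<=` U.
Proof. by have [U [UU sub]] := ultraFilterLemma (@eventually_filter); exists U. Qed.

(* Grothendieck's double limit criterion. *)
Lemma wap_no_double_limit (F h : cb R H)
    (Fwap : precompact ([set translate tau F | tau in [set: H]] : set (weak (cb R H))))
    (s t : nat -> H) (c : R) : 0 < c ->
  (forall k, F (addhl (t k) (s j)) @[j --> \oo] --> h (t k)) ->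
  ~ (forall j k, (j <= k)%N -> c <= nrm (F (addhl (t k) (s j)) - h (t k))).
Proof.
move=> c0 Fh Fc; have [U UU sub] := ultra_at_infty.
have lin_eval (r : H) : linear (fun g : cb R H => g r) by move=> a u v.
have [g gE] := translate_weak_limit Fwap s UU.
have gt k : g (t k) = h (t k).
  have [|ev evE] := @bounded_functional _ _ (fun g : cb R H => g (t k)) 1 (lin_eval _).
    by move=> f; rewrite mul1r nrm_supnorm.
  have := gE ev; rewrite !evE => gE'.
  apply: (cvg_unique_complex gE').
  by move: (Fh k) => /(cvg_trans (cvg_app _ sub)).
(* [phi] evaluates at an ultrafilter of points [t k]. For fixed j all k >= j are at distance at
   least c, so [phi] separates every translate from the limit [g] by c, although [g] is their weak
   limit. *)
have [|phi phiE] := @ultralimit_functional _ _ _ U UU (fun k (f : cb R H) => f (t k)) 1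
  (fun k => lin_eval (t k)).
  by move=> k f; rewrite mul1r nrm_supnorm.
have far j : c <= nrm (phi (translate (s j) F) - phi g).
  have : (fun k => nrm (translate (s j) F (t k) - g (t k))) @ U -->
      nrm (phi (translate (s j) F) - phi g).
    by apply: cvg_nrm; apply: cvgB; exact: phiE.
  move=> /cvgr_to_ge; apply; apply: sub; exists j => // k /= jk.
  by rewrite gt; exact: Fc.
have /cvg_nrmP/(_ c c0)/filter_ex[j] := gE phi.
by rewrite nrm_distC ltNge far.
Qed.

End weak_limits.

(** * Means on the half-line *)

Section means.
Variable R : realType.
Local Notation H := (halfline R).
Local Notation C := R[i].

Lemma hl_subproof (r : R) : Num.max r 0 \in `[0%R, +oo[%classic.
Proof. by rewrite inE /= in_itv /= andbT le_max lexx orbT. Qed.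

Definition hl (r : R) : H := exist _ (Num.max r 0) (hl_subproof r).

Lemma hlvalK r : 0 <= r -> hlval (hl r) = r.
Proof. by move=> r0; apply: max_idPl. Qed.

Lemma addhl_hl r s : 0 <= r -> 0 <= s -> addhl (hl r) (hl s) = hl (r + s).
Proof.
move=> r0 s0; apply: val_inj => /=.
by rewrite -/(hlval (hl r)) -/(hlval (hl s)) !hlvalK// (max_idPl (addr_ge0 _ _)).
Qed.

Lemma addhlA r s t : addhl r (addhl s t) = addhl (addhl r s) t :> H.
Proof. by apply: val_inj => /=; rewrite /hlval /= addrA. Qed.

Definition gridpoint (N n : nat) : H := hl (n%:R / (2 ^ N)%:R).

Definition gridsize (N : nat) : nat := (N * 2 ^ N)%N.

(* A Riemann sum, on a dyadic grid, of the mean of [g] over [[0, N]]. *)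
Definition average (N : nat) (g : H -> C) : C :=
  ((gridsize N)%:R^-1)%:C * \sum_(n < gridsize N) g (gridpoint N n).

Definition bounded_cplx (g : H -> C) := exists B, forall t, nrm (g t) <= B.

Lemma averageZD N a (f g : H -> C) :
  average N (fun t => a * f t + g t) = a * average N f + average N g.
Proof.
rewrite /average big_split /= -mulr_sumr mulrDr; congr (_ + _).
by rewrite mulrCA.
Qed.

Lemma nrm_average N (g : H -> C) B : (forall t, nrm (g t) <= B) ->
  nrm (average N g) <= B.
Proof.
move=> gB; rewrite /average nrmM nrm_real ger0_norm ?invr_ge0//.
have B0 : 0 <= B by rewrite (le_trans (nrm_ge0 _) (gB (hl 0))).
have [->|N0] := posnP (gridsize N); first by rewrite invr0 mul0r.
rewrite mulrC ler_pdivrMr ?ltr0n// (le_trans (nrm_sum _ _ _))//.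
rewrite (le_trans (ler_sum _ (fun i _ => gB _)))//.
by rewrite sumr_const card_ord mulr_natr.
Qed.

(** These translations move grid points to grid points as soon as N >= j, so for them averages of
    any bounded function, continuous or not, change only by end terms. *)
Definition dyadic (r : R) := exists i j : nat, r = i%:R / (2 ^ j)%:R.

Lemma average_shift (g : H -> C) B r : (forall t, nrm (g t) <= B) -> dyadic r ->
  \forall N \near \oo,
    nrm (average N (fun t => g (addhl t (hl r))) - average N g) <= 2 * r * B / N%:R.
Proof.
move=> gB [i [j rE]]; near=> N.
have jN : (j <= N)%N by near: N; exact: nbhs_infty_ge.
have N0 : (0 < N)%N by near: N; exact: nbhs_infty_gt.
pose p := (i * 2 ^ (N - j))%N.
have p2 k : (2 ^ k)%:R != 0 :> R by rewrite pnatr_eq0 expn_eq0.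
have rp : r = p%:R / (2 ^ N)%:R.
  rewrite rE /p -{2}(subnK jN) expnD !natrM; field.
  by rewrite !p2.
have -> : average N (fun t => g (addhl t (hl r))) - average N g =
    ((gridsize N)%:R^-1)%:C * (\sum_(n < gridsize N) g (gridpoint N (n + p)) -
      \sum_(n < gridsize N) g (gridpoint N n)).
  rewrite mulrBr; congr (_ * _ - _); apply: eq_bigr => n _.
  by rewrite /gridpoint addhl_hl ?rp ?divr_ge0// natrD mulrDl.
rewrite nrmM nrm_real ger0_norm ?invr_ge0// mulrC ler_pdivrMr; last first.
  by rewrite ltr0n muln_gt0 N0 expn_gt0.
rewrite (le_trans (@shift_sum_bound _ (fun n => g (gridpoint N n)) B _ _ _))//.
rewrite (_ : _ / _ * _ = 2 * p%:R * B)// rp /gridsize natrM; field.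
by rewrite p2 pnatr_eq0 -lt0n N0.
Unshelve. all: by end_near. Qed.

Variable U : set_system nat.
Context {UU : UltraFilter U}.
Hypothesis Uoo : \oo `<=` U.

Definition meanC (g : H -> C) : C := lim (average N g @[N --> U]).

Definition meanR (g : H -> R) : R := complex.Re (meanC (fun t => (g t)%:C)).

Lemma meanC_cvg g : bounded_cplx g -> average N g @[N --> U] --> meanC g.
Proof. by move=> [B gB]; apply: (@ultra_cvgC _ _ _ _ _ B) => N; exact: nrm_average. Qed.

Lemma meanC_eq (g : H -> C) l : average N g @[N --> U] --> l -> meanC g = l.
Proof. by move=> gl; apply: cvg_lim => //; exact: norm_hausdorff. Qed.

Lemma meanCZD a (f g : H -> C) : bounded_cplx f -> bounded_cplx g ->
  meanC (fun t => a * f t + g t) = a * meanC f + meanC g.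
Proof.
move=> bf bg; apply: meanC_eq.
under eq_fun do rewrite averageZD.
by apply: cvgD; [apply: cvgMr|]; exact: meanC_cvg.
Qed.

Lemma nrm_meanC (g : H -> C) B : (forall t, nrm (g t) <= B) -> nrm (meanC g) <= B.
Proof.
move=> gB; have h : bounded_cplx g by exists B.
by apply: (le_nrm_cvg (meanC_cvg h)); apply: filterE => N; exact: nrm_average.
Qed.

Lemma meanC_shift (g : H -> C) r : bounded_cplx g -> dyadic r ->
  meanC (fun t => g (addhl t (hl r))) = meanC g.
Proof.
move=> bg dr; have [B gB] := bg.
have bg' : bounded_cplx (fun t => g (addhl t (hl r))) by exists B.
apply: meanC_eq; rewrite -[meanC g]add0r.
have -> : (fun N => average N (fun t => g (addhl t (hl r)))) = (fun N =>
    (average N (fun t => g (addhl t (hl r))) - average N g) + average N g).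
  by apply: funext => N; rewrite subrK.
apply: cvgD; last exact: meanC_cvg.
apply/cvg_nrmP => e e0; apply: Uoo.
near=> N; rewrite sub0r nrmN.
have N0 : (0 < N)%N by near: N; exact: nbhs_infty_gt.
apply: (@le_lt_trans _ _ (2 * r * B / N%:R)); first by near: N; exact: average_shift.
rewrite ltr_pdivrMr ?ltr0n// -ltr_pdivrMl//.
near: N; exact: nbhs_infty_gtr.
Unshelve. all: by end_near. Qed.

Lemma bounded_realC (g : H -> R) : bounded_real g -> bounded_cplx (fun t => (g t)%:C).
Proof. by move=> [B gB]; exists B => t; rewrite nrm_real. Qed.

Lemma meanR_cvg (g : H -> R) : bounded_real g ->
  complex.Re (average N (fun t => (g t)%:C)) @[N --> U] --> meanR g.
Proof. by move=> /bounded_realC/meanC_cvg/cvg_Re. Qed.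

Lemma Re_average N (g : H -> C) : complex.Re (average N g) =
  (gridsize N)%:R^-1 * \sum_(n < gridsize N) complex.Re (g (gridpoint N n)).
Proof.
have ReM (r : R) (z : C) : complex.Re (r%:C * z) = r * complex.Re z.
  by case: z => a b /=; rewrite mul0r subr0.
by rewrite /average ReM raddf_sum.
Qed.

Lemma Re_meanC (g : H -> C) : bounded_cplx g ->
  complex.Re (meanC g) = meanR (fun t => complex.Re (g t)).
Proof.
move=> bg; have [B gB] := bg.
have h1 : complex.Re (average N g) @[N --> U] --> complex.Re (meanC g).
  by apply: cvg_Re; exact: meanC_cvg.
have /meanR_cvg : bounded_real (fun t => complex.Re (g t)).
  by exists B => t; rewrite (le_trans (norm_Re_le _)).
have -> : (fun N => complex.Re (average N (fun t => (complex.Re (g t))%:C))) =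
    (fun N => complex.Re (average N g)).
  by apply: funext => N; rewrite !Re_average.
by move: h1; apply: cvg_unique; exact: norm_hausdorff.
Qed.

Lemma meanR_is_mean : is_mean meanR.
Proof.
split=> [f g bf bg|c f bf|f g bf bg fg|].
- have := meanCZD 1 (bounded_realC bf) (bounded_realC bg).
  rewrite mul1r => /(congr1 (@complex.Re R)); rewrite raddfD => <-.
  by congr (complex.Re (meanC _)); apply: funext => t; rewrite mul1r rmorphD.
- have b0 : bounded_cplx (fun=> 0) by exists 0 => t; rewrite nrm0.
  have z0 : meanC (fun=> 0) = 0.
    by apply/eqP; rewrite -normr_le0 nrmE -[0]/(0%:C) lecR nrm_meanC// => t; rewrite nrm0.
  have := meanCZD c%:C (bounded_realC bf) b0.
  rewrite z0 addr0 => /(congr1 (@complex.Re R)).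
  have -> : complex.Re (c%:C * meanC (fun t => (f t)%:C)) = c * meanR f.
    by rewrite /meanR; case: (meanC _) => a b /=; rewrite mul0r subr0.
  by move=> <-; congr (complex.Re (meanC _)); apply: funext => t; rewrite addr0 rmorphM.
- apply: (ler_cvg_to (meanR_cvg bf) (meanR_cvg bg)).
  apply: filterE => N; rewrite !Re_average ler_wpM2l ?invr_ge0//.
  by apply: ler_sum => n _ /=.
- rewrite /meanR (@meanC_eq _ 1)//; apply: cvg_near_cst; apply: Uoo.
  near=> N; rewrite /average sumr_const card_ord -(rmorph_nat (real_complex R)).
  rewrite -[_%:C]/(real_complex R _) -rmorphM mulVf//= pnatr_eq0 muln_eq0 negb_or expn_eq0.
  by rewrite -lt0n andbT; near: N; exact: nbhs_infty_gt.
Unshelve. all: by end_near. Qed.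

End means.

(** * Wiener's lemma *)

Section wiener.
Variable R : realType.
Local Notation H := (halfline R).
Local Notation C := R[i].

(** Uniformity in both the frequency [z] and the base point [t] is the point. The grid step may
    depend on [e], which leaves room to take it below a modulus of continuity of [F]. *)
Definition fourier_small (F : H -> C) := forall e : R, 0 < e ->
  exists j N0 : nat, forall (N : nat) (t : H) (z : C), (N0 <= N)%N -> nrm z = 1 ->
    nrm (\sum_(n < N) F (addhl t (hl (n%:R / (2 ^ j)%:R))) * z ^+ n) <= e * N%:R.

Variable U : set_system nat.
Context {UU : UltraFilter U}.
Hypothesis Uoo : \oo `<=` U.
Local Notation meanC := (meanC U).

Lemma bounded_cplxM (f g : H -> C) : bounded_cplx f -> bounded_cplx g ->
  bounded_cplx (fun t => f t * g t).
Proof.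
by move=> [B fB] [D gD]; exists (B * D) => t; rewrite nrmM ler_pM// nrm_ge0.
Qed.

Lemma bounded_cplx_conj (f : H -> C) : bounded_cplx f ->
  bounded_cplx (fun t => conjc (f t)).
Proof. by move=> [B fB]; exists B => t; rewrite nrm_conj. Qed.

Lemma bounded_cplx_shift (f : H -> C) s : bounded_cplx f ->
  bounded_cplx (fun t => f (addhl t s)).
Proof. by move=> [B fB]; exists B. Qed.

Lemma bounded_cplx_sum (f : nat -> H -> C) S : (forall k, bounded_cplx (f k)) ->
  bounded_cplx (fun t => \sum_(k < S) f k t).
Proof.
move=> bf; elim: S => [|S [B fB]].
  by exists 0 => t; rewrite big_ord0 nrm0.
have [D fD] := bf S; exists (B + D) => t.
by rewrite big_ord_recr /= (le_trans (nrmD _ _))// lerD.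
Qed.

Lemma bounded_cplxZ (f : H -> C) a : bounded_cplx f -> bounded_cplx (fun t => a * f t).
Proof. by apply: bounded_cplxM; exists (nrm a). Qed.

Lemma meanC_sum (a : nat -> C) (f : nat -> H -> C) S : (forall k, bounded_cplx (f k)) ->
  meanC (fun t => \sum_(k < S) a k * f k t) = \sum_(k < S) a k * meanC (f k).
Proof.
move=> bf; elim: S => [|S ih].
  rewrite big_ord0; apply/eqP; rewrite -normr_le0 nrmE -[0]/(0%:C) lecR.
  by apply: nrm_meanC => t; rewrite big_ord0 nrm0.
rewrite big_ord_recr /= -ih addrC -meanCZD//.
  by congr (meanC _); apply: funext => t; rewrite big_ord_recr addrC.
by apply: (@bounded_cplx_sum (fun k t => a k * f k t)) => k; exact: bounded_cplxZ.
Qed.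

(** Let b_k be the k-th mean. The function [q] built with coefficients conj(b_k) has mean equal to
    the sum of |b_k|^2. By invariance it may be averaged over S shifts before taking means, and
    those shifts form, at each point, a correlation that [correlation_bound] controls. *)
Lemma correlation_sum_bound (F g : H -> C) (B e : R) (j N0 S : nat) : 0 < e ->
  (forall t, nrm (F t) <= B) -> (forall t, nrm (g t) <= B) ->
  (forall (N : nat) (t : H) (z : C), (N0 <= N)%N -> nrm z = 1 ->
    nrm (\sum_(n < N) F (addhl t (hl (n%:R / (2 ^ j)%:R))) * z ^+ n) <= e * N%:R) ->
  (N0 <= S)%N -> (0 < S)%N ->
  \sum_(k < S) nrm (meanC (fun t =>
      F (addhl t (hl (k%:R / (2 ^ j)%:R))) * conjc (g t))) ^+ 2 <=
    4 * B ^+ 2 * e ^+ 2 * S%:R.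
Proof.
move=> e0 FB gB Fe NS S0.
pose d k : R := k%:R / (2 ^ j)%:R.
have d0 k : 0 <= d k by rewrite divr_ge0.
have dd k : dyadic (d k) by exists k, j.
have dD k l t : addhl (addhl t (hl (d k))) (hl (d l)) = addhl t (hl (d (k + l)%N)).
  by rewrite -addhlA addhl_hl// /d natrD mulrDl.
have bF : bounded_cplx F by exists B.
have bg : bounded_cplx g by exists B.
pose f k t := F (addhl t (hl (d k))) * conjc (g t).
have bf k : bounded_cplx (f k).
  by apply: bounded_cplxM; [exact: bounded_cplx_shift|exact: bounded_cplx_conj].
pose b k := meanC (f k).
change (\sum_(k < S) nrm (b k) ^+ 2 <= 4 * B ^+ 2 * e ^+ 2 * S%:R).
move betaE : (\sum_(k < S) _) => beta.
pose q t := \sum_(k < S) conjc (b k) * f k t.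
have bq : bounded_cplx q.
  by apply: (@bounded_cplx_sum (fun k t => conjc (b k) * f k t)) => k; exact: bounded_cplxZ.
have mq : meanC q = beta%:C.
  rewrite (@meanC_sum (fun k => conjc (b k)) f)// -betaE rmorph_sum; apply: eq_bigr => k _.
  by rewrite mulrC mulcJ.
have S0' : 0 < S%:R :> R by rewrite ltr0n.
have : S%:R * beta <= nrm (meanC (fun t => \sum_(w < S) 1 * q (addhl t (hl (d w))))).
  rewrite (@meanC_sum (fun=> 1) (fun w t => q (addhl t (hl (d w))))); last first.
    by move=> k; exact: bounded_cplx_shift.
  under eq_bigr do rewrite mul1r meanC_shift//.
  rewrite mq sumr_const card_ord -[beta%:C *+ S]mulr_natl nrmM.
  rewrite -(rmorph_nat (real_complex R)) !nrm_real ger0_norm// ler_wpM2l//.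
  exact: ler_norm.
(* Weight in 2 x B <= kappa x^2 + B^2 / kappa, chosen so that the first part sums to at most
   [S * beta]; half of it is then absorbed by the left-hand side. *)
pose kappa := (4 * e ^+ 2 * S%:R)^-1.
have kappa0 : 0 < kappa by rewrite invr_gt0 !mulr_gt0// exprn_gt0.
have : nrm (meanC (fun t => \sum_(w < S) 1 * q (addhl t (hl (d w))))) <=
    2^-1 * (kappa * ((e * (S + S)%:R) ^+ 2 * beta) + S%:R * (B ^+ 2 / kappa)).
  apply: nrm_meanC => t.
  pose c w := \sum_(k < S) conjc (b k) * F (addhl t (hl (d (w + k)%N))).
  have cB : \sum_(w < S) nrm (c w) ^+ 2 <= (e * (S + S)%:R) ^+ 2 * beta.
    have -> : beta = \sum_(k < S) nrm (conjc (b k)) ^+ 2.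
      by rewrite -betaE; apply: eq_bigr => k _; rewrite nrm_conj.
    apply: (@correlation_bound R S (fun n => F (addhl t (hl (d n))))
      (fun k => conjc (b k))) => z z1.
    by apply: Fe => //; rewrite (leq_trans NS)// leq_addr.
  apply: (le_trans (nrm_sum _ _ _)).
  apply: (@le_trans _ _ (\sum_(w < S) 2^-1 * (kappa * nrm (c w) ^+ 2 + B ^+ 2 / kappa))).
    apply: ler_sum => w _; rewrite mul1r.
    have -> : q (addhl t (hl (d w))) = c w * conjc (g (addhl t (hl (d w)))).
      rewrite /q /c mulr_suml; apply: eq_bigr => k _.
      by rewrite /f dD mulrA.
    rewrite nrmM nrm_conj; set x := nrm (c w).
    apply: (@le_trans _ _ (x * B)); first by rewrite ler_wpM2l ?nrm_ge0.
    have : 0 <= kappa * (x - B / kappa) ^+ 2 by rewrite mulr_ge0 ?sqr_ge0// ltW.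
    have -> : kappa * (x - B / kappa) ^+ 2 = kappa * x ^+ 2 + B ^+ 2 / kappa - 2 * (x * B).
      by field; rewrite gt_eqF.
    lra.
  rewrite -mulr_sumr ler_wpM2l ?invr_ge0// big_split /= sumr_const card_ord.
  by apply: lerD; [rewrite -mulr_sumr ler_wpM2l// ltW|rewrite mulr_natl].
have -> : kappa * ((e * (S + S)%:R) ^+ 2 * beta) = S%:R * beta.
  by rewrite /kappa natrD; field; rewrite !gt_eqF.
have -> : B ^+ 2 / kappa = 4 * B ^+ 2 * e ^+ 2 * S%:R.
  by rewrite /kappa invrK; ring.
move=> h1 h2; rewrite -(ler_pM2l S0'); lra.
Qed.

Lemma asymptotically_orthogonal (F : H -> C) (g : nat -> H -> C) (B eta : R) (J : nat) :
  fourier_small F -> (forall t, nrm (F t) <= B) ->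
  (forall i t, nrm (g i t) <= B) -> 0 < eta ->
  exists2 r, dyadic r & forall i, (i < J)%N ->
    nrm (meanC (fun t => F (addhl t (hl r)) * conjc (g i t))) <= eta.
Proof.
move=> Fs FB gB eta0.
have B0 : 0 <= B by rewrite (le_trans (nrm_ge0 _) (FB (hl 0))).
(* This makes 4 B^2 e^2 J <= eta^2: the sum over i < J, averaged over k < S, is at most eta^2, so a
   single k serves all i at once. The added 1s keep the denominator positive. *)
pose e := eta / (2 * (B + 1) * (J%:R + 1)).
have J0 : 0 <= J%:R :> R by [].
have e0 : 0 < e by rewrite divr_gt0// !mulr_gt0// ltr_wpDl.
have [j [N0 Fe]] := Fs e e0.
pose S := N0.+1.
pose b i k := meanC (fun t => F (addhl t (hl (k%:R / (2 ^ j)%:R))) * conjc (g i t)).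
have bS i : \sum_(k < S) nrm (b i k) ^+ 2 <= 4 * B ^+ 2 * e ^+ 2 * S%:R.
  by apply: (correlation_sum_bound e0 FB (gB i) Fe).
have [k kP] : exists k : 'I_S, \sum_(i < J) nrm (b i k) ^+ 2 <= eta ^+ 2.
  apply: contrapT => /forallNP h.
  have : \sum_(k < S) eta ^+ 2 < \sum_(k < S) \sum_(i < J) nrm (b i k) ^+ 2.
    apply: ltr_sum; first by apply/hasP; exists ord0; rewrite ?mem_index_enum.
    by move=> k _; rewrite ltNge; apply/negP/h.
  apply/negP; rewrite -leNgt exchange_big /= sumr_const card_ord.
  apply: (@le_trans _ _ (\sum_(i < J) 4 * B ^+ 2 * e ^+ 2 * S%:R)).
    by apply: ler_sum => i _; exact: bS.
  rewrite sumr_const card_ord -[_ *+ J]mulr_natr -[leRHS]mulr_natr mulrAC.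
  rewrite ler_wpM2r//.
  have -> : 4 * B ^+ 2 * e ^+ 2 * J%:R =
      eta ^+ 2 * ((B / (B + 1)) ^+ 2 * (J%:R / (J%:R + 1)) * (J%:R + 1)^-1).
    by rewrite /e; field; rewrite !gt_eqF// ltr_wpDl.
  rewrite -[leRHS]mulr1 ler_wpM2l ?sqr_ge0//.
  have JJ : 0 <= J%:R / (J%:R + 1 : R) <= 1.
    by rewrite divr_ge0 ?addr_ge0//= ler_pdivrMr ?ltr_wpDl// mul1r lerDl.
  have BB : 0 <= B / (B + 1) <= 1.
    by rewrite divr_ge0 ?addr_ge0//= ler_pdivrMr ?ltr_wpDl// mul1r lerDl.
  have J1 : 0 <= (J%:R + 1 : R)^-1 <= 1.
    by rewrite invr_ge0 addr_ge0//= invf_le1 ?ltr_wpDl// lerDr.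
  move: JJ BB J1 => /andP[? ?] /andP[? ?] /andP[? ?].
  have B2 : (B / (B + 1)) ^+ 2 <= 1 by rewrite expr_le1.
  apply: mulr_ile1 => //; first by apply: mulr_ge0 => //; exact: sqr_ge0.
  by apply: mulr_ile1 => //; exact: sqr_ge0.
exists (k%:R / (2 ^ j)%:R); first by exists k, j.
move=> i iJ; rewrite -(@ler_pXn2r _ 2) ?nnegrE ?nrm_ge0 ?(ltW eta0)//.
apply: le_trans kP; rewrite (bigD1 (Ordinal iJ))//= -/(b i k) lerDl.
by apply: sumr_ge0 => *; exact: sqr_ge0.
Qed.

End wiener.

(** * Vanishing of the quadratic mean *)

Section wap_null.
Variable R : realType.
Local Notation H := (halfline R).
Local Notation C := R[i].
Variable U : set_system nat.
Context {UU : UltraFilter U}.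
Hypothesis Uoo : \oo `<=` U.
Local Notation meanC := (meanC U).
Local Notation meanR := (meanR U).

Lemma orthogonal_translates (F : H -> C) : bounded_cplx F -> fourier_small F ->
  exists2 s : nat -> R, forall n, dyadic (s n) &
    forall j n, (j < n)%N ->
      nrm (meanC (fun t => F (addhl t (hl (s n))) * conjc (F (addhl t (hl (s j)))))) <=
      n.+1%:R^-1.
Proof.
move=> [B FB] Fs.
pose ortho r r' := nrm (meanC (fun t => F (addhl t (hl r)) * conjc (F (addhl t (hl r'))))).
(* The state is the whole list of chosen shifts, since the next one must be nearly orthogonal to all
   of them. *)
have step (l : seq R) : {l' | exists2 r, l' = rcons l r &
    dyadic r /\ forall i, (i < size l)%N -> ortho r (nth 0 l i) <= (size l).+1%:R^-1}.
  apply: cid; have [|||r dr rl] := @asymptotically_orthogonal _ _ _ Uoo F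
      (fun i t => F (addhl t (hl (nth 0 l i)))) B (size l).+1%:R^-1 (size l) Fs => //.
  by exists (rcons l r), r.
have [f [f0 fS]] := dependent_choice step [::].
have size_f n : size (f n) = n.
  by elim: n => [|n ih]; [rewrite f0|have [r -> _] := fS n; rewrite size_rcons ih].
pose s n := nth 0 (f n.+1) n.
have nth_f m n : (n < m)%N -> nth 0 (f m) n = s n.
  elim: m => // m ih; rewrite ltnS leq_eqVlt => /orP[/eqP ->//|nm].
  by have [r -> _] := fS m; rewrite nth_rcons size_f nm ih.
have sE n : dyadic (s n) /\ forall i, (i < n)%N -> ortho (s n) (s i) <= n.+1%:R^-1.
  rewrite {1 2}/s; have [r -> [dr rl]] := fS n.
  rewrite nth_rcons size_f ltnn eqxx; split=> // i ni.
  by rewrite -(nth_f n i ni); have := rl i; rewrite size_f; exact.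
by exists s => [n|j n jn]; [have [] := sE n|have [_] := sE n; exact].
Qed.

(* With [h] a weak limit of translates of [F] that are asymptotically
   orthogonal for [meanC], [h] is orthogonal to all of them, so that the
   functions [|F (. + s n) - h|^2] have mean at least that of [|F|^2], although
   they tend to [0] pointwise. *)
Lemma wap_mean_sqr_eq0 (F : cb R H) :
  precompact ([set translate tau F | tau in [set: H]] : set (weak (cb R H))) ->
  fourier_small F -> meanR (fun t => nrm (F t) ^+ 2) <= 0.
Proof.
move=> Fwap Fs; rewrite leNgt; apply/negP => d0.
set d := meanR _ in d0.
have mm : is_mean meanR := @meanR_is_mean R U UU Uoo.
have bcb (g : cb R H) : bounded_cplx g by exists (nrm g) => t; exact: nrm_supnorm.
have bsq (g : H -> C) : bounded_cplx g -> bounded_real (fun t => nrm (g t) ^+ 2).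
  move=> [B gB]; exists (B ^+ 2) => t.
  by rewrite normrX ler_pXn2r ?nnegrE ?ger0_norm ?nrm_ge0// (le_trans (nrm_ge0 _) (gB t)).
have bF := bcb F.
have [s ds so] := orthogonal_translates bF Fs.
have [h hE] := translate_weak_limit Fwap (fun n => hl (s n)) UU.
have bh := bcb h.
pose Fn n t := F (addhl t (hl (s n))).
have bFn n : bounded_cplx (Fn n) by exact: bounded_cplx_shift.
(* For fixed j the mean against conj([Fn j]) is a bounded functional of the other factor, so weak
   convergence of the translates passes through it, while [so] sends the values to 0. *)
have hF j : meanC (fun t => h t * conjc (Fn j t)) = 0.
  have bM (g : cb R H) : bounded_cplx (fun t => g t * conjc (Fn j t)).
    by apply: bounded_cplxM => //; exact: bounded_cplx_conj.
  have [||phi phiE] := @bounded_functional _ _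
      (fun g : cb R H => meanC (fun t => g t * conjc (Fn j t))) (nrm F).
  - move=> a u v; apply: etrans (meanCZD a (bM u) (bM v)); congr (meanC _).
    by apply: funext => t; rewrite mulrA -mulrDl.
  - move=> g; apply: nrm_meanC => t; rewrite nrmM nrm_conj mulrC.
    by rewrite ler_pM ?nrm_ge0// nrm_supnorm.
  have := hE phi; rewrite phiE => hphi; apply: (cvg_unique_complex hphi).
  apply/cvg_nrmP => e e0; apply: Uoo; near=> n.
  rewrite sub0r nrmN.
  have jn : (j < n)%N by near: n; exact: nbhs_infty_gt.
  apply: (le_lt_trans (so _ _ jn)).
  by near: n; exact: near_infty_natSinv_lt (PosNum e0).
pose u n t := nrm (Fn n t - h t) ^+ 2.
have bu n : bounded_real (u n).
  apply: bsq; have [B FB] := bFn n; have [D hD] := bh.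
  by exists (B + D) => t; rewrite (le_trans (nrmB _ _))// lerD.
have [||||nn [tt [ut u0]]] := @mean_dominated_convergence R H meanR mm U UU u
    ((nrm F + nrm h) ^+ 2) (d / 2).
- by rewrite divr_gt0.
- move=> n t; rewrite sqr_ge0 /= ler_pXn2r ?nnegrE ?addr_ge0 ?nrm_ge0//.
  by rewrite (le_trans (nrmB _ _))// lerD// nrm_supnorm.
- move=> t; have [|ev evE] := @bounded_functional _ _ (fun g : cb R H => g t) 1
    (fun _ _ _ => erefl).
    by move=> f; rewrite mul1r nrm_supnorm.
  have := hE ev; rewrite evE => /cvg_nrm0P h0.
  rewrite -(mulr0 0); under eq_fun do rewrite /u expr2.
  by apply: cvgM; exact: h0.
- move=> n; rewrite mulrC divfK//.
  have bF2 := bsq _ (bFn n); have bh2 := bsq _ bh.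
  have bhF : bounded_cplx (fun t => h t * conjc (Fn n t)).
    by apply: bounded_cplxM => //; exact: bounded_cplx_conj.
  have bRe : bounded_real (fun t => complex.Re (h t * conjc (Fn n t))).
    by have [B hB] := bhF; exists B => t; rewrite (le_trans (norm_Re_le _)).
  have bRe2 : bounded_real (fun t => - 2 * complex.Re (h t * conjc (Fn n t))).
    by apply: bounded_realM => //; exact: bounded_real_const.
  have -> : u n = (fun t => (nrm (Fn n t) ^+ 2 + nrm (h t) ^+ 2) +
      - 2 * complex.Re (h t * conjc (Fn n t))).
    by apply: funext => t; rewrite /u sqr_nrmB mulNr.
  rewrite (meanD mm) ?(meanD mm) ?(meanZ mm)//; last exact: bounded_realD.
  rewrite -Re_meanC// hF mulr0 addr0.
  have -> : meanR (fun t => nrm (Fn n t) ^+ 2) = d.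
    rewrite /d /meanR.
    have := @meanC_shift R U UU Uoo (fun r => (nrm (F r) ^+ 2)%:C) (s n).
    by rewrite /Fn => ->//; apply/bounded_realC/bsq.
  rewrite lerDl; have := meanZ mm 0 bh2; rewrite mul0r => <-; apply: (mean_le mm) => //.
    by apply: bounded_realM => //; exact: bounded_real_const.
  by move=> t; rewrite mul0r sqr_ge0.
have c0 : 0 < Num.sqrt (d / 2) by rewrite sqrtr_gt0 divr_gt0.
have sqrt_le j k : Num.sqrt (d / 2) <= nrm (F (addhl (tt k) (hl (s (nn j)))) - h (tt k)) <->
    d / 2 <= u (nn j) (tt k).
  rewrite -(@ler_pXn2r _ 2) ?nnegrE ?sqrtr_ge0 ?nrm_ge0//.
  by rewrite sqr_sqrtr// divr_ge0// ltW.
apply: (wap_no_double_limit Fwap (s := fun j => hl (s (nn j))) (h := h) (t := tt) c0).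
  move=> k; apply/cvg_nrmP => e e0; have /cvgrPdist_lt/(_ (e ^+ 2)) := u0 k.
  rewrite exprn_gt0// => /(_ isT); apply: filterS => j.
  rewrite sub0r normrN ger0_norm ?sqr_ge0// nrm_distC.
  by rewrite ltr_pXn2r ?nnegrE ?nrm_ge0// ltW.
by move=> j k jk; apply/sqrt_le/ut.
Unshelve. all: by end_near. Qed.

End wap_null.

(** * Averages on refined grids *)

Section cis.
Variable R : realType.
Implicit Types a b : R.

Definition cis a : R[i] := cos a +i* sin a.

Lemma cis0 : cis 0 = 1.
Proof. by rewrite /cis cos0 sin0. Qed.

Lemma cisD a b : cis (a + b) = cis a * cis b.
Proof.
rewrite /cis cosD sinD; apply/eqP; rewrite eq_complex /=.
by rewrite [cos a * sin b + _]addrC !eqxx.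
Qed.

Lemma cisX a n : cis (a * n%:R) = cis a ^+ n.
Proof.
elim: n => [|n ih]; first by rewrite mulr0 cis0.
by rewrite -natr1 mulrDr mulr1 cisD ih exprSr.
Qed.

Lemma nrm_cis a : nrm (cis a) = 1.
Proof.
by apply/eqP; rewrite -(@eqrXn2 _ 2)// ?nrm_ge0// sqr_nrm /= cos2Dsin2 expr1n.
Qed.

Lemma cvg_cis (T : Type) (F : set_system T) {FF : Filter F} (u : T -> R) a :
  u @ F --> a -> cis (u x) @[x --> F] --> cis a.
Proof.
move=> ua; apply: cvg_complex.
  exact: (cvg_comp _ _ ua (@continuous_cos R a)).
exact: (cvg_comp _ _ ua (@continuous_sin R a)).
Qed.

(** Arguments are taken in [-pi, pi] because cos decreases with the modulus of the angle there, as
    used in [ler_cos]. *)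
Lemma nrm1_cis (z : R[i]) : nrm z = 1 -> exists2 a, `|a| <= pi & z = cis a.
Proof.
move=> z1; have z2 := sqr_nrm z; rewrite z1 expr1n in z2.
have Re1 : -1 <= complex.Re z <= 1 by rewrite -ler_norml -z1 norm_Re_le.
have aB : 0 <= acos (complex.Re z) <= pi by rewrite acos_ge0// acos_lepi.
have sa : sin (acos (complex.Re z)) = `|complex.Im z|.
  by rewrite sin_acos// -sqrtr_sqr; congr Num.sqrt; rewrite z2; ring.
have ca : cos (acos (complex.Re z)) = complex.Re z by apply: acosK; rewrite in_itv.
have /andP[a0 api] := aB.
have [Im0|Im0] := leP 0 (complex.Im z).
  exists (acos (complex.Re z)); first by rewrite ger0_norm.
  by rewrite /cis ca sa ger0_norm//; case: (z).
exists (- acos (complex.Re z)); first by rewrite normrN ger0_norm.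
by rewrite /cis cosN sinN ca sa ltr0_norm// opprK; case: (z).
Qed.

Lemma ler_cos a b : `|b| <= pi -> `|a| <= `|b| -> cos b <= cos a.
Proof.
move=> bpi ab; rewrite -(cos_norm a) -(cos_norm b) leNgt ltr_cos -?leNgt//.
  by rewrite in_itv /= normr_ge0.
by rewrite in_itv /= normr_ge0 (le_trans ab).
Qed.

End cis.

Section refined_averages.
Variable R : realType.
Local Notation C := R[i].

Lemma sum_ord_mul (V : zmodType) (F : nat -> V) (N q : nat) :
  \sum_(n < N * q) F n = \sum_(n < N) \sum_(l < q) F (n * q + l)%N.
Proof.
elim: N => [|N ih]; first by rewrite !big_ord0.
by rewrite big_ord_recr /= -ih mulSn addnC big_split_ord.
Qed.

Lemma nrm_natV n : nrm ((n%:R^-1)%:C : C) = n%:R^-1.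
Proof. by rewrite nrm_real ger0_norm ?invr_ge0. Qed.

(* The grid of step [d / q] refines the grid of step [d], and [cis (a / q)] is
   the [q]-th root of [cis a] that stays close to [1]. *)
Definition refined_average (Y : R -> C) (tau d a : R) (N q : nat) : C :=
  ((N * q)%:R^-1)%:C *
  \sum_(n < N * q) cis (a * (n%:R / q%:R)) * Y (tau + d * (n%:R / q%:R)).

Lemma nrm_refined_average (Y : R -> C) (tau d a B : R) N q : 0 <= tau -> 0 <= d ->
  0 <= B -> (forall t, 0 <= t -> nrm (Y t) <= B) ->
  nrm (refined_average Y tau d a N q) <= B.
Proof.
move=> tau0 d0 B0 YB; rewrite nrmM nrm_natV.
have [->|Nq] := posnP (N * q)%N; first by rewrite invr0 mul0r.
rewrite mulrC ler_pdivrMr ?ltr0n// (le_trans (nrm_sum _ _ _))//.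
apply: (@le_trans _ _ (\sum_(n < N * q) B)).
  apply: ler_sum => n _; rewrite nrmM nrm_cis mul1r YB//.
  by rewrite addr_ge0// mulr_ge0// divr_ge0.
by rewrite sumr_const card_ord mulr_natr.
Qed.

(** Summation by parts: 2 B comes from the ends and N w from the increments. For slowly varying [Y],
    a large sum thus forces z to be close to 1. *)
Lemma nrm_1B_frequency (Y : nat -> C) (B w : R) N (z : C) : nrm z = 1 ->
  (forall n, nrm (Y n) <= B) -> (forall n, nrm (Y n.+1 - Y n) <= w) ->
  nrm (1 - z) * nrm (\sum_(n < N) Y n * z ^+ n) <= 2 * B + N%:R * w.
Proof.
move=> z1 YB Yw; rewrite -nrmM.
have -> : (1 - z) * (\sum_(n < N) Y n * z ^+ n) =
    \sum_(n < N) (Y n.+1 - Y n) * z ^+ n.+1 -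
    (\sum_(n < N) Y (n + 1)%N * z ^+ (n + 1) - \sum_(n < N) Y n * z ^+ n).
  have -> : \sum_(n < N) (Y n.+1 - Y n) * z ^+ n.+1 =
      \sum_(n < N) Y (n + 1)%N * z ^+ (n + 1) - z * (\sum_(n < N) Y n * z ^+ n).
    rewrite mulr_sumr -sumrB; apply: eq_bigr => n _.
    by rewrite addn1 exprS; ring.
  by ring.
rewrite (le_trans (nrmB _ _))// addrC; apply: lerD.
  have := @shift_sum_bound R (fun n => Y n * z ^+ n) B N 1; rewrite mulr1; apply => n.
  by rewrite nrmM nrmX z1 expr1n mulr1.
rewrite (le_trans (nrm_sum _ _ _))//.
apply: (@le_trans _ _ (\sum_(n < N) w)).
  by apply: ler_sum => n _; rewrite nrmM nrmX z1 expr1n mulr1.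
by rewrite sumr_const card_ord mulr_natl.
Qed.

(** Inside a coarse cell the phases [cis (a * (l / q))] have real part at least cos a >= 1/2, so
    their sum keeps half of its maximal modulus q; replacing [Y] by its value at the start of the
    cell costs w. *)
Lemma refined_average_ge (Y : R -> C) (tau d a e w : R) N q : 0 <= tau -> 0 <= d ->
  (0 < N)%N -> (0 < q)%N -> `|a| <= pi -> 2^-1 <= cos a ->
  (forall s t, 0 <= s -> 0 <= t -> `|s - t| <= d -> nrm (Y s - Y t) <= w) ->
  e * N%:R <= nrm (\sum_(n < N) Y (tau + d * n%:R) * cis a ^+ n) ->
  e / 2 - w <= nrm (refined_average Y tau d a N q).
Proof.
move=> tau0 d0 N0 q0 api ca Yw eN.
have q0' : 0 < q%:R :> R by rewrite ltr0n.
have N0' : 0 < N%:R :> R by rewrite ltr0n.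
have lq (l : 'I_q) : 0 <= (l%:R / q%:R : R) <= 1.
  by rewrite divr_ge0//= ler_pdivrMr// mul1r ler_nat ltnW.
rewrite nrmM nrm_natV [leRHS]mulrC ler_pdivlMr ?ltr0n ?muln_gt0 ?N0//.
set S := \sum_(n < N) _ in eN.
pose D : C := \sum_(l < q) cis (a * (l%:R / q%:R)).
pose err n l := cis (a * ((n * q + l)%N%:R / q%:R)) *
  (Y (tau + d * ((n * q + l)%N%:R / q%:R)) - Y (tau + d * n%:R)).
have nql n l : (n * q + l)%N%:R / q%:R = n%:R + l%:R / q%:R :> R.
  by rewrite natrD natrM mulrDl mulfK// gt_eqF.
have -> : \sum_(n < N * q) cis (a * (n%:R / q%:R)) * Y (tau + d * (n%:R / q%:R)) =
    D * S + \sum_(n < N) \sum_(l < q) err n l.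
  rewrite (@sum_ord_mul _ (fun n => cis (a * (n%:R / q%:R)) * Y (tau + d * (n%:R / q%:R)))).
  rewrite mulr_sumr -big_split /=; apply: eq_bigr => n _.
  rewrite mulr_suml -big_split /=; apply: eq_bigr => l _.
  by rewrite /err nql mulrDr cisD cisX; ring.
have errw : nrm (\sum_(n < N) \sum_(l < q) err n l) <= N%:R * (q%:R * w).
  rewrite (le_trans (nrm_sum _ _ _))// mulr_natl.
  apply: (@le_trans _ _ (\sum_(n < N) q%:R * w)); last by rewrite sumr_const card_ord.
  apply: ler_sum => n _; rewrite (le_trans (nrm_sum _ _ _))//.
  apply: (@le_trans _ _ (\sum_(l < q) w)); last by rewrite sumr_const card_ord mulr_natl.
  apply: ler_sum => l _; rewrite nrmM nrm_cis mul1r.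
  have /andP[l0 l1] := lq l.
  apply: Yw; rewrite ?addr_ge0 ?mulr_ge0// nql ?addr_ge0//.
  have -> : tau + d * (n%:R + l%:R / q%:R) - (tau + d * n%:R) = d * (l%:R / q%:R) by ring.
  by rewrite ger0_norm ?mulr_ge0// ler_piMr.
have Dq : q%:R / 2 <= nrm D.
  apply: le_trans (le_trans (ler_norm _) (norm_Re_le D)).
  rewrite raddf_sum /= -[q in leLHS]card_ord -[_%:R]/(_%:R : R) mulrC mulr_natr -sumr_const.
  apply: ler_sum => l _; apply: le_trans ca _; apply: ler_cos => //.
  have /andP[l0 l1] := lq l.
  by rewrite normrM (ger0_norm l0) ler_piMr.
have : q%:R / 2 * (e * N%:R) <= nrm D * nrm S.
  have [e0|e0] := leP 0 e; first by apply: ler_pM => //; rewrite ?mulr_ge0 ?divr_ge0.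
  apply: (@le_trans _ _ 0); last by rewrite mulr_ge0 ?nrm_ge0.
  by rewrite mulr_ge0_le0 ?divr_ge0// mulr_le0_ge0// ltW.
rewrite -nrmM => DS.
have := nrmB (D * S + \sum_(n < N) \sum_(l < q) err n l) (\sum_(n < N) \sum_(l < q) err n l).
rewrite addrK natrM => h.
have -> : (e / 2 - w) * (N%:R * q%:R) = q%:R / 2 * (e * N%:R) - N%:R * (q%:R * w) by field.
lra.
Qed.

(** Up to rounding, a translation by r is p fine steps of length d / q, and reindexing by p turns it
    into a phase. Rounding costs w; the end terms cost 2 p B / (N q), at most the second error
    term. *)
Lemma refined_average_shift (Y : R -> C) (tau d a B w r : R) N q p : 0 <= tau -> 0 < d ->
  (0 < N)%N -> (0 < q)%N -> 0 <= r ->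
  (forall t, 0 <= t -> nrm (Y t) <= B) ->
  (forall s t, 0 <= s -> 0 <= t -> `|s - t| <= d / q%:R -> nrm (Y s - Y t) <= w) ->
  p%:R <= r * q%:R / d < p.+1%:R ->
  nrm (refined_average (fun t => Y (t + r)) tau d a N q -
       cis (- (a * (p%:R / q%:R))) * refined_average Y tau d a N q) <=
  w + 2 * (r / d) * B / N%:R.
Proof.
move=> tau0 d0 N0 q0 r0 YB Yw /andP[pr rp].
have q0' : 0 < q%:R :> R by rewrite ltr0n.
have N0' : 0 < N%:R :> R by rewrite ltr0n.
have B0 : 0 <= B by rewrite (le_trans (nrm_ge0 _) (YB 0 _)).
pose b n := cis (a * (n%:R / q%:R)) * Y (tau + d * (n%:R / q%:R)).
have pos n : 0 <= tau + d * (n%:R / q%:R).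
  by rewrite addr_ge0// mulr_ge0 ?divr_ge0// ltW.
pose c n := cis (a * (n%:R / q%:R)) *
  (Y (tau + d * (n%:R / q%:R) + r) - Y (tau + d * ((n + p)%N%:R / q%:R))).
have -> : refined_average (fun t => Y (t + r)) tau d a N q -
       cis (- (a * (p%:R / q%:R))) * refined_average Y tau d a N q =
  ((N * q)%:R^-1)%:C * (\sum_(n < N * q) c n + cis (- (a * (p%:R / q%:R))) *
   (\sum_(n < N * q) b (n + p)%N - \sum_(n < N * q) b n)).
  rewrite /refined_average mulrCA -mulrBr; congr (_ * _).
  rewrite [_ * (_ - _)]mulrBr addrA; congr (_ - _).
  rewrite mulr_sumr -big_split; apply: eq_bigr => n _ /=.
  rewrite /b /c [cis (- _) * _]mulrA -cisD.
  have -> : - (a * (p%:R / q%:R)) + a * ((n + p)%N%:R / q%:R) = a * (n%:R / q%:R).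
    by rewrite natrD; ring.
  by ring.
rewrite nrmM nrm_natV [leLHS]mulrC ler_pdivrMr ?ltr0n ?muln_gt0 ?N0//.
have cw : nrm (\sum_(n < N * q) c n) <= (N * q)%:R * w.
  rewrite (le_trans (nrm_sum _ _ _))//.
  apply: (@le_trans _ _ (\sum_(n < N * q) w)); last by rewrite sumr_const card_ord mulr_natl.
  apply: ler_sum => n _; rewrite nrmM nrm_cis mul1r.
  apply: Yw => //; first by rewrite addr_ge0.
  have -> : tau + d * (n%:R / q%:R) + r - (tau + d * ((n + p)%N%:R / q%:R)) =
      (r * q%:R / d - p%:R) * (d / q%:R).
    by rewrite natrD; field; rewrite !gt_eqF.
  rewrite normrM [`|d / _|]ger0_norm; last by rewrite divr_ge0// ltW.
  rewrite ler_piMl ?divr_ge0 ?(ltW d0)// ger0_norm ?subr_ge0//.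
  by rewrite lerBlDl natr1 ltW.
have bB := @shift_sum_bound R b B (N * q) p.
rewrite (le_trans (nrmD _ _))// [nrm (cis _ * _)]nrmM nrm_cis mul1r.
have -> : (w + 2 * (r / d) * B / N%:R) * (N * q)%:R =
    (N * q)%:R * w + 2 * (r * q%:R / d) * B.
  by rewrite natrM; field; rewrite !gt_eqF.
apply: lerD => //; apply: (le_trans (bB _)).
  by move=> n; rewrite /b nrmM nrm_cis mul1r YB.
by rewrite ler_wpM2r// ler_wpM2l.
Qed.

End refined_averages.

(** * Eigenfunctionals in the sun dual *)

Section sun_orbits.
Variables (R : realType) (X : completeNormedModType R[i]) (T : R -> bop X X).
Hypothesis c0T : c0_semigroup T.
Hypothesis bT : bounded_semigroup T.
Local Notation C := R[i].

Lemma semigroup_bound : exists2 M : R, 0 <= M &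
  forall t v, 0 <= t -> nrm (T t v) <= M * nrm v.
Proof.
have /pinfty_ex_gt0[M M0 TM] := bT.
exists (complex.Re M) => [|t v t0]; first by rewrite -lecR ge0_ReK// ltW.
rewrite -lecR rmorphM /= -!nrmE ge0_ReK ?(ltW M0)//.
apply: (le_trans (opnorm_ub (T t) v)); rewrite ler_wpM2r//.
by apply: TM; rewrite /= in_itv /= andbT.
Qed.

Lemma orbit_bound (y : dual X) (v : X) : exists2 B : R, 0 <= B &
  forall t, 0 <= t -> nrm (y (T t v)) <= B.
Proof.
have [M M0 TM] := semigroup_bound; have [K K0 yK] := dual_nrm_ub y.
exists (K * (M * nrm v)) => [|t t0]; first by rewrite !mulr_ge0// nrm_ge0.
by rewrite (le_trans (yK _))// ler_wpM2l// TM.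
Qed.

(** For s <= t the difference is T(t-s)* y - y evaluated at T(s) v, and T(s) v is bounded: norm
    continuity of T(r)* y at r = 0 yields uniform continuity on the whole half-line. *)
Lemma sun_orbit_modulus (y : dual X) (v : X) (e : R) : sun_dual T y -> 0 < e ->
  exists2 d : R, 0 < d & forall s t, 0 <= s -> 0 <= t -> `|s - t| <= d ->
    nrm (y (T s v) - y (T t v)) <= e.
Proof.
move=> /cvg_nrmP sy e0; have [M M0 TM] := semigroup_bound.
have D0 : 0 < M * nrm v + 1 by rewrite ltr_wpDl// mulr_ge0// nrm_ge0.
have [T0 TD _] := c0T.
have /sy : 0 < e / (M * nrm v + 1) by rewrite divr_gt0.
move=> [d /= d0 h].
have yd r u : 0 <= r -> r < d -> nrm (y (T r u) - y u) <= e / (M * nrm v + 1) * nrm u.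
  rewrite le_eqVlt => /orP[/eqP <- _|r0 rd].
    by rewrite T0 subrr nrm0 mulr_ge0 ?nrm_ge0// divr_ge0// ltW.
  have := h r; rewrite /ball_ /= sub0r normrN gtr0_norm// => /(_ rd r0).
  rewrite sub0r nrmN => yr.
  apply: le_trans (_ : nrm (adjoint (T r) y - y) * nrm u <= _); last first.
    rewrite ler_wpM2r ?nrm_ge0// ltW//; move: yr.
    by rewrite /nrm normr_id.
  rewrite -lecR rmorphM /= -!nrmE.
  exact: (opnorm_ub (adjoint (T r) y - y) u).
(* Halved because [yd] requires times strictly below d. *)
exists (d / 2); first by rewrite divr_gt0.
have le_case s t : 0 <= s -> s <= t -> `|s - t| <= d / 2 ->
    nrm (y (T s v) - y (T t v)) <= e.
  move=> s0 st; rewrite distrC ger0_norm ?subr_ge0// => std.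
  have {1}-> : t = (t - s) + s by rewrite subrK.
  rewrite TD ?subr_ge0// nrm_distC.
  apply: (le_trans (yd (t - s) (T s v) _ _)); first by rewrite subr_ge0.
    by rewrite (le_lt_trans std)// ltr_pdivrMr// mulr2n mulrDr mulr1 ltrDl.
  rewrite -mulrA ler_piMr ?(ltW e0)// mulrC ler_pdivrMr// mul1r.
  by rewrite (le_trans (TM _ _ s0))// lerDl.
move=> s t s0 t0 std; have [st|/ltW ts] := leP s t; first exact: le_case.
by rewrite nrm_distC le_case// distrC.
Qed.

Lemma cis_quotient_cvg (w : R) :
  (h^-1)%:C * (cis (w * h) - 1) @[h --> 0^'+] --> (0 +i* w : C).
Proof.
have D f df : is_derive (0 : R) 1 f df ->
    (h^-1 * (f h - f 0)) @[h --> 0^'+] --> (df : R).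
  move=> [ef <-]; apply: cvg_dnbhs_at_right.
  have := ef; rewrite /derivable /derive => /cvg_ex[l hl].
  have -> : lim (h^-1 *: ((f \o shift 0) (h *: 1) - f 0) @[h --> 0^']) = l by exact: cvg_lim.
  by move: hl; under eq_fun do rewrite /= addr0 -[_ *: 1]/(_ * 1) mulr1.
have ReE (r : R) (z : C) : complex.Re (r%:C * z) = r * complex.Re z.
  by case: z => a b /=; rewrite mul0r subr0.
have ImE (r : R) (z : C) : complex.Im (r%:C * z) = r * complex.Im z.
  by case: z => a b /=; rewrite mul0r addr0.
apply: cvg_complex.
  under eq_fun do rewrite ReE raddfB /=.
  have := D (fun h => cos (w * h)) 0; rewrite mulr0 cos0; apply.
  by apply: is_derive_eq; rewrite mulr0 sin0 oppr0 mul0r.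
under eq_fun do rewrite ImE raddfB /= subr0.
have := D (fun h => sin (w * h)) w; rewrite mulr0 sin0.
have -> : (fun h => h^-1 * (sin (w * h) - 0)) = (fun h => h^-1 * sin (w * h)).
  by apply: funext => h; rewrite subr0.
apply.
by apply: is_derive_eq; rewrite mulr0 cos0 mul1r -[w%:A]/(w * 1) mulr1.
Qed.

(** A weak-star limit lies a priori only in X*. The phase relation itself makes T(r)* y norm
    continuous at r = 0, which puts y and its multiples into the sun dual; differentiating the
    relation at 0 then gives A* y = i w y. *)
Lemma no_eigenfunctional (A : set (X * X)) (y : dual X) (w : R) (x : X) :
  A = generator T -> point_spectrum (sun_generator T A) `&` @imaginary_axis R = set0 ->
  (forall r v, 0 <= r -> y (T r v) = cis (w * r) * y v) -> y x = 0.
Proof.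
move=> AT pA yT; apply: contrapT => yx.
have adjE r : 0 <= r -> adjoint (T r) y = cis (w * r) *: y.
  by move=> r0; apply: bopP => v; exact: yT.
have sunZ (z : C) : sun_dual T (z *: y).
  have w0 : w * t @[t --> 0^'+] --> w * 0.
    apply: cvgM; first exact: cvg_cst.
    by apply: cvg_at_right_filter; exact: cvg_id.
  have : cis (w * t) @[t --> 0^'+] --> cis (w * 0) by exact: cvg_cis w0.
  move=> /cvg_nrm0P c0.
  have : nrm (cis (w * t) - cis (w * 0)) * nrm (z *: y) @[t --> 0^'+] --> 0 * nrm (z *: y).
    by apply: cvgM => //; exact: cvg_cst.
  rewrite mul0r mulr0 cis0 => c1; apply/cvg_nrm0P; apply: cvg_trans c1.
  apply: near_eq_cvg; near=> t.
  have t0 : 0 <= t by apply: ltW; near: t; exact: nbhs_right_gt.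
  rewrite subr0 -nrmZ [RHS]/nrm normr_id; congr (complex.Re `| _ |).
  rewrite scalerBl scale1r; congr (_ - _); apply: bopP => v.
  have -> : adjoint (T t) (z *: y) v = z * y (T t v) by [].
  by rewrite yT// mulrCA.
have /seteqP[] := pA; move=> /(_ (0 +i* w)) h _; apply: h; split=> //.
exists y.
  by apply/eqP => y0; apply: yx; rewrite y0.
split; [|by rewrite -[y]scale1r; exact: sunZ|exact: sunZ].
move=> [u v] Auv /=; have {}Auv : generator T (u, v) by rewrite -AT.
have y1 : y ((h^-1)%:C *: (T h u - u)) @[h --> 0^'+] --> y v.
  by apply: (cvg_comp _ _ Auv); exact: bop_continuous.
have y2 : (h^-1)%:C * (cis (w * h) - 1) * y u @[h --> 0^'+] --> (0 +i* w) * y u.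
  by apply: cvgMl; exact: cis_quotient_cvg.
have : y ((h^-1)%:C *: (T h u - u)) @[h --> 0^'+] --> (0 +i* w) * y u.
  apply: cvg_trans y2; apply: near_eq_cvg; near=> h.
  have h0 : 0 <= h by apply: ltW; near: h; exact: nbhs_right_gt.
  rewrite linearZ linearB /= yT// -[_ *: _]/(_ * _); ring.
by move: y1; apply: cvg_unique; exact: norm_hausdorff.
Unshelve. all: by end_near. Qed.

End sun_orbits.

(** * Uniform smallness of the Fourier averages of an orbit *)

Section fourier_small_orbit.
Variables (R : realType) (X : completeNormedModType R[i]) (T : R -> bop X X).
Hypothesis c0T : c0_semigroup T.
Hypothesis bT : bounded_semigroup T.
Variable A : set (X * X).
Hypothesis AT : A = generator T.
Hypothesis pA : point_spectrum (sun_generator T A) `&` @imaginary_axis R = set0.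
Local Notation C := R[i].

(* A sequence of grid averages of step [d], with frequencies near [1], that does
   not tend to [0]; refining the grids yields in the limit an eigenfunctional. *)
Lemma refined_averages_contra (x : X) (y : dual X) (d e w : R)
    (N : nat -> nat) (tau a : nat -> R) : sun_dual T y -> 0 < d ->
  (forall k, (k < N k)%N) -> (forall k, 0 <= tau k) -> (forall k, `|a k| <= pi) ->
  (forall k, 2^-1 <= cos (a k)) -> w < e / 2 ->
  (forall s t, 0 <= s -> 0 <= t -> `|s - t| <= d -> nrm (y (T s x) - y (T t x)) <= w) ->
  (forall k, e * (N k)%:R <=
    nrm (\sum_(n < N k) y (T (tau k + d * n%:R) x) * cis (a k) ^+ n)) -> False.
Proof.
move=> sy d0 kN tau0 api ca we yw eN.
have [_ TD _] := c0T.
have N0 k : (0 < N k)%N by exact: leq_trans (kN k).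
have [M M0 TM] := semigroup_bound bT.
have [K K0 yK] := dual_nrm_ub y.
pose Y v t := y (T t v).
have YB v t : 0 <= t -> nrm (Y v t) <= K * M * nrm v.
  by move=> t0; rewrite (le_trans (yK _))// -mulrA ler_wpM2l// TM.
(* The refinement k + 1 grows with k, so in the limit any real r >= 0 is a whole number of fine
   steps. As [a k] is the phase gained per time d, the limit frequency is -a0 / d. *)
pose f k v := refined_average (Y v) (tau k) d (a k) (N k) k.+1.
have [U UU Uoo] := ultra_at_infty.
have [||g gE] := @ultralimit_functional R X nat U UU f (K * M).
- move=> k b u v; rewrite [RHS](_ : _ = b * f k u + f k v)//.
  rewrite /f /refined_average mulrCA -mulrDr.
  congr (_ * _); rewrite mulr_sumr -big_split /=; apply: eq_bigr => n _.
  have -> t : Y (b *: u + v) t = b * Y u t + Y v t by rewrite /Y !linearP.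
  by ring.
- move=> k v; apply: nrm_refined_average => //; first exact: ltW.
    by rewrite !mulr_ge0// nrm_ge0.
  by move=> t t0; exact: YB.
have /cvg_ex[a0 aU] : cvg (a @ U) by exact: (@ultra_cvg _ _ _ _ _ pi).
have gx : e / 2 - w <= nrm (g x).
  apply: (cvgr_to_ge (cvg_nrm (gE x))); apply: filterE => k.
  by apply: refined_average_ge => //; exact: ltW.
suff gT r v : 0 <= r -> g (T r v) = cis (- (a0 / d) * r) * g v.
  have g0 := no_eigenfunctional x AT pA gT.
  by move: gx; rewrite g0 nrm0 subr_le0 leNgt we.
move=> r0.
pose p k := Num.truncn (r * k.+1%:R / d).
have pP k : (p k)%:R <= r * k.+1%:R / d < (p k).+1%:R.
  by apply: truncn_itv; rewrite divr_ge0 ?mulr_ge0// ltW.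
have pk : (p k)%:R / k.+1%:R @[k --> U] --> r / d.
  apply/cvgrPdist_le => e' e'0; apply: Uoo; near=> k.
  have k0 : 0 < k.+1%:R :> R by [].
  have -> : r / d - (p k)%:R / k.+1%:R = (r * k.+1%:R / d - (p k)%:R) / k.+1%:R.
    by field; rewrite !gt_eqF.
  have /andP[p1 p2] := pP k.
  rewrite normrM [`|_^-1|]ger0_norm ?invr_ge0// ger0_norm ?subr_ge0//.
  apply: (@le_trans _ _ (k.+1%:R^-1)).
    by rewrite ler_piMl ?invr_ge0// lerBlDl natr1 ltW.
  by apply: ltW; near: k; exact: near_infty_natSinv_lt (PosNum e'0).
have cisU : cis (- (a k * ((p k)%:R / k.+1%:R))) @[k --> U] --> cis (- (a0 / d) * r).
  have -> : - (a0 / d) * r = - (a0 * (r / d)) by ring.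
  by apply: cvg_cis; apply: cvgN; apply: cvgM.
have h1 : f k (T r v) - cis (- (a k * ((p k)%:R / k.+1%:R))) * f k v @[k --> U] -->
    g (T r v) - cis (- (a0 / d) * r) * g v.
  exact: cvgB (gE (T r v)) (cvgM cisU (gE v)).
apply/eqP; rewrite -subr_eq0 -normr_le0 nrmE -[0]/(0%:C) lecR leNgt.
apply/negP => c0; set c := nrm _ in c0.
have [dl dl0 dlP] := sun_orbit_modulus c0T bT v sy (divr_gt0 c0 (ltr0n R 4)).
(* For large k one quarter of c bounds the rounding error, the fine step d / (k + 1) being below the
   modulus of continuity, and another quarter bounds the end terms, as N k > k. *)
have : c <= c / 2.
  apply: (le_nrm_cvg h1); apply: Uoo; near=> k.
  have Yr : f k (T r v) = refined_average (fun t => Y v (t + r)) (tau k) d (a k) (N k) k.+1.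
    rewrite /f /refined_average; congr (_ * _); apply: eq_bigr => n _; congr (_ * _).
    by rewrite /Y (TD (_ + d * _) r)// addr_ge0// mulr_ge0 ?divr_ge0// ltW.
  rewrite Yr.
  have k0 : 0 < k.+1%:R :> R by [].
  have h := @refined_average_shift R (Y v) (tau k) d (a k) (K * M * nrm v) (c / 4) r
    (N k) k.+1 (p k) (tau0 k) d0 (N0 k) _ r0 (YB v) _ (pP k).
  apply: (le_trans (h _ _)) => //.
    move=> s t s0 t0 st; apply: dlP => //; apply: (le_trans st).
    rewrite ler_pdivrMr// -ler_pdivrMl//; apply: (@le_trans _ _ k%:R); last by rewrite ler_nat.
    by near: k; exact: nbhs_infty_ger.
  have -> : c / 2 = c / 4 + c / 4 by field.
  rewrite lerD2l ler_pdivrMr ?ltr0n// -ler_pdivrMl ?divr_gt0//.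
  apply: (@le_trans _ _ k%:R); last by rewrite ler_nat ltnW.
  by near: k; exact: nbhs_infty_ger.
lra.
Unshelve. all: by end_near. Qed.

Lemma fourier_small_orbit (x : X) (y : dual X) : sun_dual T y ->
  fourier_small (fun t : halfline R => y (T (hlval t) x)).
Proof.
move=> sy; apply: contrapT => /existsNP[e /not_implyP[e0 /forallNP h]].
have [B B0 YB] := orbit_bound bT y x.
have [dl dl0 dlP] := sun_orbit_modulus c0T bT x sy (divr_gt0 e0 (ltr0n R 8)).
have [j jP] : exists j : nat, ((2 ^ j)%:R^-1 : R) <= dl.
  exists (Num.bound dl^-1); rewrite -[leRHS]invrK lef_pV2 ?posrE ?invr_gt0 ?ltr0n ?expn_gt0//.
  rewrite ltW// (lt_le_trans (archi_boundP _)) ?invr_ge0 ?(ltW dl0)//.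
  by rewrite ler_nat; apply/ltnW/ltn_expl.
set d := _^-1 in jP; have d0 : 0 < d by rewrite invr_gt0 ltr0n expn_gt0.
(* For N >= 16 B / e both terms of [nrm_1B_frequency], with increments at most e / 8, are at most e
   N / 8. Hence |1 - z| <= 1/4 and Re z >= 3/4, more than the 1/2 that refinement asks for. *)
pose K0 := Num.bound (16 * B / e).
have bad k : exists f : nat * R * C,
    [/\ (k < f.1.1)%N, (K0 <= f.1.1)%N, 0 <= f.1.2, nrm f.2 = 1 &
    e * f.1.1%:R < nrm (\sum_(n < f.1.1) y (T (f.1.2 + d * n%:R) x) * f.2 ^+ n)].
  have /forallNP/(_ (maxn k.+1 K0)) := h j.
  move=> /existsNP[N /existsNP[t /existsNP[z /not_implyP[kN /not_implyP[z1 /negP]]]]].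
  rewrite -ltNge => eN; exists (N, hlval t, z) => /=; split => //.
  - by rewrite (leq_trans _ kN)// leq_maxl.
  - by rewrite (leq_trans _ kN)// leq_maxr.
  - exact: hlval_ge0.
  - rewrite (lt_le_trans eN)// le_eqVlt; apply/orP; left; apply/eqP; congr nrm.
    apply: eq_bigr => n _; congr (y (T _ x) * _).
    rewrite -[LHS]/(hlval t + hlval (hl (n%:R / (2 ^ j)%:R))).
    by rewrite hlvalK ?divr_ge0// mulrC.
have [Nt NtP] := choice bad.
pose N k := (Nt k).1.1; pose tau k := (Nt k).1.2; pose z k := (Nt k).2.
have z1 k : nrm (z k) = 1 by have [] := NtP k.
have arg k : exists b, `|b| <= pi /\ z k = cis b.
  by have [b] := nrm1_cis (z1 k); exists b.
have [a aP] := choice arg.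
apply: (@refined_averages_contra x y d e (e / 8) N tau a) => //.
- by move=> k; have [] := NtP k.
- by move=> k; have [] := NtP k.
- by move=> k; have [] := aP k.
- move=> k; have [_ K0N tk _ eN] := NtP k; have [_ zk] := aP k.
  have N0 : 0 < (N k)%:R :> R.
    by rewrite ltr0n; have [kN _ _ _ _] := NtP k; exact: leq_trans kN.
  have := @nrm_1B_frequency R (fun n => y (T (tau k + d * n%:R) x)) B (e / 8) (N k) (z k)
    (z1 k).
  have pos n : 0 <= tau k + d * n%:R by rewrite addr_ge0// mulr_ge0// ltW.
  move=> /(_ (fun n => YB _ (pos n))) H1.
  have {}H1 := H1 _.
  have zN : nrm (1 - z k) * (e * (N k)%:R) <= 2 * B + (N k)%:R * (e / 8).
    apply: le_trans (H1 _).
      by rewrite ler_wpM2l ?nrm_ge0// ltW.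
    move=> n; apply: dlP => //.
    rewrite -[n.+1%:R]natr1 (_ : _ - _ = d); last by ring.
    by rewrite ger0_norm// ltW.
  have BN : 16 * B <= e * (N k)%:R.
    rewrite -ler_pdivrMl// mulrC.
    apply: (@le_trans _ _ K0%:R); last by rewrite ler_nat.
    by rewrite ltW// archi_boundP// divr_ge0 ?mulr_ge0// ltW.
  have : nrm (1 - z k) <= 4^-1.
    rewrite -(ler_pM2r (mulr_gt0 e0 N0)); lra.
  move=> z4; have := le_trans (ler_norm _) (le_trans (norm_Re_le (1 - z k)) z4).
  rewrite raddfB /= zk /=; lra.
- lra.
- by move=> s t s0 t0 st; apply: dlP => //; exact: le_trans jP.
- by move=> k; have [_ _ _ _ eN] := NtP k; have [_ <-] := aP k; exact: ltW.
Qed.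

End fourier_small_orbit.

(** * Riemann sums *)

Section riemann_sums.
Variables (R : realType) (g : R -> R).
Local Notation mu := (@lebesgue_measure R).
Hypothesis g0 : forall t, 0 <= g t.
Hypothesis ug : forall e, 0 < e -> exists2 d, 0 < d & forall s t, `|s - t| <= d ->
  `|g s - g t| <= e.

Lemma uniform_continuous : continuous g.
Proof.
move=> t; apply/cvgrPdist_le => e /ug[d d0 gd]; near=> s; apply: gd.
by apply: ltW; near: s; apply: cvgr_dist_lt => //; exact: cvg_id.
Unshelve. all: by end_near. Qed.

Lemma uniform_integrable (i : interval R) (a b : R) : [set` i] `<=` `[a, b] ->
  mu.-integrable [set` i] (EFin \o g).
Proof.
move=> iab; apply: (@integrableS _ _ _ mu `[a, b]%classic) => //.
apply: continuous_compact_integrable; first exact: segment_compact.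
by apply: continuous_subspaceT; exact: uniform_continuous.
Qed.

Lemma Rintegral_split (a b c : R) : a <= b -> b <= c ->
  \int[mu]_(t in `[a, c]) g t = \int[mu]_(t in `[a, b]) g t + \int[mu]_(t in `]b, c]) g t.
Proof.
move=> ab bc; rewrite -(@Rintegral_itvB R g (BLeft a) (BRight c) b) ?bnd_simp//.
  by rewrite addrC subrK.
exact: (@uniform_integrable _ a c).
Qed.

Lemma Rintegral_le_riemann (d w : R) (K : nat) : 0 < d ->
  (forall s t, `|s - t| <= d -> `|g s - g t| <= w) ->
  \int[mu]_(t in `[0, K%:R * d]) g t <= \sum_(n < K) d * (g (n%:R * d) + w).
Proof.
move=> d0 gw; elim: K => [|K ih].
  by rewrite big_ord0 mul0r set_itv1 Rintegral_set1.
have Kd : K%:R * d <= K.+1%:R * d by rewrite ler_wpM2r ?(ltW d0)// ler_nat.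
rewrite (@Rintegral_split _ (K%:R * d))// ?mulr_ge0 ?(ltW d0)//.
rewrite big_ord_recr lerD//=.
have KK : K.+1%:R * d = K%:R * d + d by rewrite -natr1 mulrDl mul1r.
apply: (@le_trans _ _ (\int[mu]_(t in `]K%:R * d, K.+1%:R * d]) (g (K%:R * d) + w))).
  apply: le_Rintegral => //.
  - apply: (@uniform_integrable _ (K%:R * d) (K.+1%:R * d)).
    by apply: subset_itvr; rewrite bnd_simp.
  - apply: (@integrableS _ _ _ mu `[K%:R * d, K.+1%:R * d]%classic) => //.
      by apply: subset_itvr; rewrite bnd_simp.
    apply: continuous_compact_integrable; first exact: segment_compact.
    by apply: continuous_subspaceT => t; exact: cst_continuous.
  move=> t /=; rewrite in_itv /= KK => /andP[Kt tK].
  have : `|g t - g (K%:R * d)| <= w by apply: gw; rewrite ger0_norm; lra.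
  by move=> /(le_trans (ler_norm _)); rewrite lerBlDl.
rewrite Rintegral_cst// [X in fine X](_ : _ = d%:E); first by rewrite /= mulrC.
apply: etrans (lebesgue_measure_itv _) _.
by rewrite /= lte_fin KK ltrDl d0 -EFinB addrAC subrr add0r.
Qed.

(** With N the integer part of tau plus 1, positivity of g bounds the integral over [0, tau] by the
    one over [0, N], and N <= 2 tau once tau >= 1. The average and the Riemann error each contribute
    e / 4, times 2 tau. *)
Lemma Rintegral_average_cvg0 :
  (gridsize N)%:R^-1 * (\sum_(n < gridsize N) g (n%:R / (2 ^ N)%:R)) @[N --> \oo] --> 0 ->
  tau^-1 * (\int[mu]_(t in `[0, tau]) g t) @[tau --> +oo] --> (0 : R).
Proof.
move=> /cvgrPdist_le avg0; apply/cvgrPdist_le => e e0.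
have e4 : 0 < e / 4 by rewrite divr_gt0.
have [d d0 gd] := ug e4.
have [N0 _ N0P] := avg0 _ e4.
pose N1 := maxn N0 (Num.bound d^-1).
near=> tau.
have tau1 : 1 <= tau by near: tau; exact: nbhs_pinfty_ge.
have tauN1 : N1%:R <= tau by near: tau; exact: nbhs_pinfty_ge.
have tau0 : 0 < tau by exact: lt_le_trans tau1.
pose N := (Num.truncn tau).+1.
have /andP[Nt tN] := truncn_itv (ltW tau0).
have N2 : N%:R <= 2 * tau by rewrite /N -natr1; lra.
have N1N : (N1 <= N)%N by rewrite -(ler_nat R) ltW// (le_lt_trans tauN1).
have p2 : 0 < (2 ^ N)%:R^-1 :> R by rewrite invr_gt0 ltr0n expn_gt0.
have pd : (2 ^ N)%:R^-1 <= d.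
  rewrite -[leRHS]invrK lef_pV2 ?posrE ?invr_gt0 ?ltr0n ?expn_gt0//.
  rewrite ltW// (lt_le_trans (archi_boundP _)) ?invr_ge0 ?(ltW d0)//.
  rewrite ler_nat (leq_trans (leq_maxr N0 _))// (leq_trans N1N)//.
  exact/ltnW/ltn_expl.
have int0 : 0 <= \int[mu]_(t in `[0, tau]) g t by apply: Rintegral_ge0.
rewrite sub0r normrN ger0_norm; last by rewrite mulr_ge0// invr_ge0 ltW.
rewrite mulrC ler_pdivrMr//.
have NE : N%:R = (gridsize N)%:R * (2 ^ N)%:R^-1 :> R.
  by rewrite natrM mulfK// pnatr_eq0 expn_eq0.
have h1 : \int[mu]_(t in `[0, tau]) g t <= \int[mu]_(t in `[0, N%:R]) g t.
  rewrite (@Rintegral_split 0 tau N%:R) ?(ltW tau0) ?(ltW tN)// lerDl.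
  exact: Rintegral_ge0.
have h2 := @Rintegral_le_riemann _ (e / 4) (gridsize N) p2
  (fun s t st => gd s t (le_trans st pd)).
rewrite -NE in h2.
have /N0P : (N0 <= N)%N by rewrite (leq_trans _ N1N)// leq_maxl.
rewrite /= sub0r normrN => /(le_trans (ler_norm _)); set S := \sum_(n < _) _ => h3.
have h4 : \sum_(n < gridsize N) (2 ^ N)%:R^-1 * (g (n%:R / (2 ^ N)%:R) + e / 4) =
    N%:R * ((gridsize N)%:R^-1 * S + e / 4).
  rewrite -mulr_sumr big_split /= sumr_const card_ord -[_ *+ gridsize N]mulr_natl -/S NE.
  by field; rewrite !pnatr_eq0 muln_eq0 expn_eq0.
rewrite h4 in h2.
apply: (le_trans h1); apply: (le_trans h2).
apply: (@le_trans _ _ (2 * tau * (e / 4 + e / 4))); last lra.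
apply: ler_pM => //; last by rewrite lerD2r.
apply: addr_ge0; last exact: ltW.
by rewrite mulr_ge0 ?invr_ge0//; apply: sumr_ge0.
Unshelve. all: by end_near. Qed.

End riemann_sums.

(** * From means along ultrafilters to Cesaro limits *)

Lemma average_nrm_cvg0 (R : realType) (f : halfline R -> R[i]) : bounded_cplx f ->
  (forall U : set_system nat, UltraFilter U -> \oo `<=` U ->
    meanR U (fun t => nrm (f t) ^+ 2) <= 0) ->
  complex.Re (average N (fun t => (nrm (f t))%:C)) @[N --> \oo] --> (0 : R).
Proof.
move=> [B fB] f2; apply/cvgrPdist_lt => e e0; apply: contrapT => nev.
pose a N := complex.Re (average N (fun t => (nrm (f t))%:C)).
have a0 N : 0 <= a N.
  by rewrite /a Re_average mulr_ge0 ?invr_ge0//; apply: sumr_ge0 => n _; exact: nrm_ge0.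
(* If the averages do not tend to 0, for some e this set meets every eventual set; the mean of |f|
   along an ultrafilter containing it and refining [\oo] is at least e. *)
pose S := [set N | e <= a N].
have pS : ProperFilter (within S \oo).
  apply: Build_ProperFilter_ex => P WP; apply: contrapT => /forallNP nP.
  have {}WP : \forall N \near \oo, S N -> P N by exact: WP.
  apply: nev; apply: filterS WP => N PN.
  by rewrite sub0r normrN (ger0_norm (a0 N)) ltNge; apply/negP => /PN /nP.
have [U [UU sU]] := ultraFilterLemma pS.
have Uoo : \oo `<=` U by move=> P oP; apply: sU; apply: filterS oP => N PN _.
have mm : is_mean (meanR U) := @meanR_is_mean R U UU Uoo.
have bf : bounded_real (fun t => nrm (f t)).
  by exists B => t; rewrite ger0_norm ?nrm_ge0.
have bf2 : bounded_real (fun t => nrm (f t) ^+ 2).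
  by under eq_fun do rewrite expr2; exact: bounded_realM.
have b1 (c : R) : bounded_real (fun _ : halfline R => c) by exact: bounded_real_const.
have ef : e <= meanR U (fun t => nrm (f t)).
  apply: (cvgr_to_ge (meanR_cvg bf)); apply: sU.
  have : \forall N \near \oo, S N -> e <= a N by apply: filterE.
  exact.
(* By |f| <= e/2 + |f|^2 / (2e), a mean of |f|^2 that is at most 0 leaves at most e/2 for the mean
   of |f|. *)
have : meanR U (fun t => nrm (f t)) <=
    meanR U (fun t => e / 2 * 1 + (2 * e)^-1 * nrm (f t) ^+ 2).
  apply: (mean_le mm) => // [|t].
    by apply: bounded_realD => //; exact: bounded_realM.
  have : 0 <= (2 * e)^-1 * (nrm (f t) - e) ^+ 2.
    by rewrite mulr_ge0 ?sqr_ge0// invr_ge0 mulr_ge0// ltW.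
  have -> : (2 * e)^-1 * (nrm (f t) - e) ^+ 2 =
    e / 2 * 1 + (2 * e)^-1 * nrm (f t) ^+ 2 - nrm (f t) by field; rewrite gt_eqF.
  lra.
rewrite (meanD mm)//; last exact: bounded_realM.
rewrite !(meanZ mm)// (mean1 mm) => h.
have : (2 * e)^-1 * meanR U (fun t => nrm (f t) ^+ 2) <= 0.
  by rewrite mulr_ge0_le0 ?f2// invr_ge0 mulr_ge0// ltW.
lra.
Qed.

Lemma norm_max0B (R : realType) (s t : R) :
  `|Num.max s 0 - Num.max t 0| <= `|s - t|.
Proof.
have h1 := ler_norm (s - t); have h2 := ler_norm (t - s); rewrite (distrC t s) in h2.
have h0 := normr_ge0 (s - t); rewrite ler_norml; apply/andP.
by have [s0|s0] := ltP s 0; have [t0|t0] := ltP t 0; split; lra.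
Qed.

Theorem corollary7p12 (R : realType) (X : completeNormedModType R[i])
    (T : R -> bop X X) (A : set (X * X)) :
  c0_semigroup T -> bounded_semigroup T -> A = generator T ->
  point_spectrum (sun_generator T A) `&` @imaginary_axis R = set0 ->
  (forall (x : X) (y : dual X), sun_dual T y ->
     eberlein_wap (fun t : halfline R => sun_semigroup T (hlval t) y x)) ->
  forall (x : X) (y : dual X), sun_dual T y ->
    tau^-1 * (\int[lebesgue_measure]_(t in `[0, tau])
                Normc.normc (sun_semigroup T t y x))
      @[tau --> +oo] --> (0 : R).
Proof.
move=> c0T bT AT pA wapT x y sy.
have [F FE Fwap] := wapT x y sy.
have Ft t : F t = y (T (hlval t) x) by rewrite -FE.
have Fs : fourier_small F.
  by rewrite -FE; exact: (fourier_small_orbit c0T bT AT pA).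
have bF : bounded_cplx F by exists (nrm F) => t; exact: nrm_supnorm.
have avg0 := average_nrm_cvg0 bF
  (fun U UU Uoo => @wap_mean_sqr_eq0 R U UU Uoo F Fwap Fs).
(* Negative times are frozen at 0, so that uniform continuity holds on all of R, where the Riemann
   sum lemmas ask for it. *)
pose g t := nrm (y (T (Num.max t 0) x)).
have ug e : 0 < e -> exists2 d, 0 < d & forall s t, `|s - t| <= d -> `|g s - g t| <= e.
  move=> e0; have [d d0 yd] := sun_orbit_modulus c0T bT x sy e0.
  exists d => // s t st.
  have max0 (r : R) : 0 <= Num.max r 0 by rewrite le_max lexx orbT.
  have nrm_dist (u v : R[i]) : nrm u - nrm v <= nrm (u - v).
    by rewrite lerBlDr -{1}(subrK v u) nrmD.
  have mst : `|Num.max s 0 - Num.max t 0| <= d.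
    exact: le_trans (norm_max0B _ _) st.
  rewrite ler_norml lerNl opprB; apply/andP; split; apply: (le_trans (nrm_dist _ _)).
    by rewrite nrm_distC yd.
  exact: yd.
have g0 t : 0 <= g t by exact: nrm_ge0.
have := @Rintegral_average_cvg0 R g g0 ug.
have -> : (fun N => (gridsize N)%:R^-1 * \sum_(n < gridsize N) g (n%:R / (2 ^ N)%:R)) =
    (fun N => complex.Re (average N (fun t => (nrm (F t))%:C))).
  apply: funext => N; rewrite Re_average; congr (_ * _); apply: eq_bigr => n _ /=.
  by rewrite Ft.
move=> /(_ avg0); apply: cvg_trans; apply: near_eq_cvg; near=> tau.
congr (_ * _); apply: eq_Rintegral => t; rewrite inE /= in_itv /= => /andP[t0 _].
by rewrite /g (max_idPl t0).
Unshelve. all: by end_near. Qed.
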